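(* Let $E=X_{\mathrm{AH}}\oplus\ell_\infty$. Then the ideal \[ \mathscr{K}_1=\left\{\begin{pmatrix} T_{1,1} & T_{1,2} \\ T_{2,1} & T_{2,2} \end{pmatrix}\in\mathscr{B}(E): T_{1,1}\text{ is compact}\right\} \] is the unique non-fixed, finitely-generated, maximal left ideal of $\mathscr{B}(E)$. Hence \[ \mathscr{W}_2=\left\{\begin{pmatrix} T_{1,1} & T_{1,2} \\ T_{2,1} & T_{2,2} \end{pmatrix}\in\mathscr{B}(E): T_{2,2}\text{ is weakly compact}\right\}, \] which is a maximal two-sided ideal of $\mathscr{B}(E)$, is not contained in any finitely-generated, maximal left ideal of $\mathscr{B}(E)$.
   Context: All Banach spaces are complex; operators are bounded and linear, and $\mathscr{B}(E)$ is the Banach algebra of operators on $E$. $X_{\mathrm{AH}}$ denotes Argyros–Haydon's Banach space (S. A. Argyros and R. G. Haydon, Acta Math. 206 (2011), 1–54); it is a Banach space with the following properties, which are a theorem of Argyros and Haydon and may be taken as given: (1) $X_{\mathrm{AH}}$ has very few operators, that is, it is infinite-dimensional and each operator on it is the sum of a scalar multiple of the identity and a compact operator; (2) $X_{\mathrm{AH}}$ has a Schauder basis; (3) the dual space of $X_{\mathrm{AH}}$ is isomorphic to $\ell_1$. $\ell_\infty=\ell_\infty(\mathbb{N})$ is the Banach space of bounded complex sequences with the supremum norm. $X_{\mathrm{AH}}\oplus\ell_\infty$ carries the norm $\|(x,f)\|=\max\{\|x\|,\|f\|_\infty\}$. Operators $T$ on $E$ are identified with $2\times2$ matrices with entries $T_{1,1}\colon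 X_{\mathrm{AH}}\to X_{\mathrm{AH}}$, $T_{1,2}\colon\ell_\infty\to X_{\mathrm{AH}}$, $T_{2,1}\colon X_{\mathrm{AH}}\to\ell_\infty$, $T_{2,2}\colon\ell_\infty\to\ell_\infty$. An operator is weakly compact if it maps the unit ball to a relatively weakly compact set. A left ideal is finitely generated if it equals $\{\sum_{T\in\Gamma}S_TT: S_T\in\mathscr{B}(E)\}$ for some non-empty finite $\Gamma\subseteq\mathscr{B}(E)$. A maximal left ideal is fixed if it equals $\{T\in\mathscr{B}(E):Tx=0\}$ for some $x\in E\setminus\{0\}$. *)

(* Defs.v *)
From HB Require Import structures.
From mathcomp Require Import all_boot all_order all_algebra finmap.
From mathcomp Require Import complex.
From mathcomp Require Import all_classical all_reals all_analysis.

Set Implicit Arguments.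
Unset Strict Implicit.
Unset Printing Implicit Defensive.

Import Order.TTheory GRing.Theory Num.Theory.
Import numFieldNormedType.Exports.

Local Open Scope classical_set_scope.
Local Open Scope ring_scope.
Local Open Scope complex_scope.

(* Norms of normed modules over R[i] take values in R[i]; suprema and series
   of norms are formed in R, after this projection. *)
Definition rnorm (R : realType) (E : normedZmodType R[i]) (x : E) : R :=
  complex.Re `|x|.

Section RnormTheory.
Variable R : realType.

Lemma rnormE (E : normedZmodType R[i]) (x : E) : `|x| = (rnorm x)%:C.
Proof. by rewrite /rnorm RRe_real// normr_real. Qed.

Lemma rnorm_ge0 (E : normedZmodType R[i]) (x : E) : 0 <= rnorm x.
Proof. by rewrite -lecR -rnormE normr_ge0. Qed.

Lemma rnormD (E : normedZmodType R[i]) (x y : E) :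
  rnorm (x + y) <= rnorm x + rnorm y.
Proof. by rewrite -lecR rmorphD /= -!rnormE ler_normD. Qed.

Lemma rnorm0_eq0 (E : normedZmodType R[i]) (x : E) : rnorm x = 0 -> x = 0.
Proof. by move=> x0; apply/eqP; rewrite -normr_eq0 rnormE x0. Qed.

Lemma rnorm0 (E : normedZmodType R[i]) : rnorm (0 : E) = 0.
Proof. by rewrite /rnorm normr0. Qed.

Lemma rnormZ (E : normedModType R[i]) (a : R[i]) (x : E) :
  rnorm (a *: x) = rnorm (a : R[i]^o) * rnorm x.
Proof.
by apply: (@complexI R); rewrite rmorphM /= -!rnormE normrZ.
Qed.

End RnormTheory.

(* The space B(E, F) of bounded linear operators, with the operator norm. *)
Section BoundedOperators.
Variables (R : realType) (E F : normedModType R[i]).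

Definition bounded_linear : {pred E -> F} :=
  mem [set T : E -> F |
    linear T /\ exists M : R[i], forall x, `|T x| <= M * `|x|].

Record op := Op { op_fun :> E -> F; op_funP : op_fun \in bounded_linear }.

HB.instance Definition _ := [isSub for op_fun].
HB.instance Definition _ := [Choice of op by <:].

Fact bounded_linear_submod_closed : submod_closed bounded_linear.
Proof.
split=> [|a S T].
  rewrite inE; split=> [b x y|]; first by rewrite /= scaler0 addr0.
  by exists 0 => x; rewrite normr0 mul0r.
rewrite !inE => -[linS [M SM]] [linT [N TN]]; split=> [b x y|].
  rewrite !fctE linS linT !scalerDr !scalerA (mulrC a b) -!addrA.
  by congr (_ + _); rewrite addrCA.
exists (`|a| * M + N) => x; rewrite !fctE.
rewrite (le_trans (ler_normD _ _))// mulrDl lerD// normrZ -mulrA.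
by rewrite ler_wpM2l.
Qed.

HB.instance Definition _ :=
  GRing.isSubmodClosed.Build _ _ bounded_linear bounded_linear_submod_closed.
HB.instance Definition _ := [SubChoice_isSubLmodule of op by <:].

Fact op_is_linear (T : op) : linear T.
Proof. by case: T => T /= /[!inE] -[]. Qed.

HB.instance Definition _ (T : op) :=
  GRing.isLinear.Build R[i] E F *:%R (op_fun T) (op_is_linear T).

Lemma opD (S T : op) x : (S + T) x = S x + T x. Proof. by []. Qed.

Lemma opZ (a : R[i]) (T : op) x : (a *: T) x = a *: T x. Proof. by []. Qed.

Lemma op_ext (S T : op) : (forall x, S x = T x) -> S = T.
Proof. by move=> ST; apply/val_inj/funext. Qed.

Lemma op_bounded (T : op) :
  exists2 M : R[i], 0 <= M & forall x, `|T x| <= M * `|x|.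
Proof.
case: T => T /= /[!inE] -[_ [M TM]]; exists `|M| => // x.
have Mx0 : 0 <= M * `|x| by rewrite (le_trans _ (TM x)).
by rewrite (le_trans (TM x))// -[leLHS]ger0_norm// normrM normr_id.
Qed.

Definition op_rnorm (T : op) : R :=
  sup [set rnorm (T x) | x in [set x : E | `|x| <= 1]].

Let op_has_sup (T : op) :
  has_sup [set rnorm (T x) | x in [set x : E | `|x| <= 1]].
Proof.
split; first by exists (rnorm (T 0)), 0 => //=; rewrite normr0.
have [M M0 TM] := op_bounded T.
exists (rnorm (M : R[i]^o)) => _ [x /= x1 <-].
by rewrite -lecR -!rnormE (le_trans (TM x))// ger0_norm// ler_piMr.
Qed.

Let op_rnorm_ub (T : op) x : `|x| <= 1 -> rnorm (T x) <= op_rnorm T.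
Proof. by move=> x1; apply: sup_upper_bound => //; exists x. Qed.

Let op_rnorm_le (T : op) c :
  (forall x, `|x| <= 1 -> rnorm (T x) <= c) -> op_rnorm T <= c.
Proof.
by move=> Tc; apply: ge_sup; [case: (op_has_sup T)|move=> _ [x /Tc ? <-]].
Qed.

Fact op_normD (S T : op) :
  (op_rnorm (S + T))%:C <= (op_rnorm S)%:C + (op_rnorm T)%:C.
Proof.
rewrite -rmorphD lecR; apply: op_rnorm_le => x x1.
by rewrite opD (le_trans (rnormD _ _))// lerD// op_rnorm_ub.
Qed.

Let op_rnormZ_le a (T : op) :
  op_rnorm (a *: T) <= rnorm (a : R[i]^o) * op_rnorm T.
Proof.
apply: op_rnorm_le => x x1.
by rewrite opZ rnormZ ler_wpM2l ?rnorm_ge0 ?op_rnorm_ub.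
Qed.

Let op_rnorm_ge0 (T : op) : 0 <= op_rnorm T.
Proof. by rewrite (le_trans (rnorm_ge0 (T 0)))// op_rnorm_ub// normr0. Qed.

Fact op_normZ a (T : op) : (op_rnorm (a *: T))%:C = `|a| * (op_rnorm T)%:C.
Proof.
rewrite (rnormE (a : R[i]^o)) -rmorphM /=; congr (_%:C).
apply/eqP; rewrite eq_le op_rnormZ_le /=.
have [->|a0] := eqVneq a 0; first by rewrite rnorm0 mul0r.
have ra0 : 0 < rnorm (a : R[i]^o) by rewrite -ltcR -rnormE normr_gt0.
rewrite -ler_pdivlMl// -{1}(scalerK a0 T).
rewrite (le_trans (op_rnormZ_le _ _))// ler_wpM2r// -lecR.
by rewrite fmorphV /= -!rnormE normfV.
Qed.

Fact op_norm_eq0 (T : op) : (op_rnorm T)%:C = 0 -> T = 0.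
Proof.
move=> /(@complexI R) T0; apply: op_ext => x.
have [->|x0] := eqVneq x 0; first by rewrite !linear0.
have nx0 : `|x| != 0 by rewrite normr_eq0.
have : T (`|x|^-1 *: x) = 0.
  apply: rnorm0_eq0; apply/eqP; rewrite eq_le rnorm_ge0 andbT -T0 op_rnorm_ub//.
  by rewrite normrZ normfV normr_id mulVf.
by rewrite linearZ /= => /eqP; rewrite scaler_eq0 invr_eq0 (negPf nx0) => /eqP.
Qed.

HB.instance Definition _ :=
  Lmodule_isNormed.Build R[i] op op_normD op_normZ op_norm_eq0.

End BoundedOperators.

Arguments bounded_linear {R} E F.

Section Composition.
Variable R : realType.

Fact op_comp_subproof (E F G : normedModType R[i]) (S : op F G) (T : op E F) :
  S \o T \in bounded_linear E G.
Proof.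
rewrite inE; split=> [a x y|]; first by rewrite /= !linearP.
have [M M0 SM] := op_bounded S; have [N N0 TN] := op_bounded T.
by exists (M * N) => x /=; rewrite (le_trans (SM _))// -mulrA ler_wpM2l.
Qed.

Definition op_comp (E F G : normedModType R[i]) (S : op F G) (T : op E F) :
  op E G := Op (op_comp_subproof S T).

Fact op_id_subproof (E : normedModType R[i]) : idfun \in bounded_linear E E.
Proof. by rewrite inE; split=> //; exists 1 => x; rewrite mul1r. Qed.

Definition op_id (E : normedModType R[i]) : op E E := Op (op_id_subproof E).

Section Ring.
Variable E : normedModType R[i].

Let op_compA : associative (@op_comp E E E).
Proof. by move=> S T U; exact: op_ext. Qed.

Let op_comp1l : left_id (op_id E) (@op_comp E E E).
Proof. by move=> T; exact: op_ext. Qed.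

Let op_comp1r : right_id (op_id E) (@op_comp E E E).
Proof. by move=> T; exact: op_ext. Qed.

Let op_compDl : left_distributive (@op_comp E E E) +%R.
Proof. by move=> S T U; exact: op_ext. Qed.

Let op_compDr : right_distributive (@op_comp E E E) +%R.
Proof. by move=> S T U; apply: op_ext => x; exact: linearD. Qed.

(* The ring B(E): the product S * T is the composition S \o T. *)
HB.instance Definition _ := GRing.Zmodule_isPzRing.Build (op E E)
  op_compA op_comp1l op_comp1r op_compDl op_compDr.

End Ring.

Definition isomorphic (E F : normedModType R[i]) :=
  exists (T : op E F) (S : op F E),
    op_comp S T = op_id E /\ op_comp T S = op_id F.

Definition dual (E : normedModType R[i]) := op E R[i]^o.

End Composition.

Section EllInfty.
Variable R : realType.

Definition bounded_seq : {pred nat -> R[i]^o} :=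
  mem (bounded_fun : set (nat -> R[i]^o)).

Record ell_infty :=
  EllInfty { ell_infty_seq :> nat -> R[i]^o; _ : ell_infty_seq \in bounded_seq }.

HB.instance Definition _ := [isSub for ell_infty_seq].
HB.instance Definition _ := [Choice of ell_infty by <:].

Let bounded_seqP (f : nat -> R[i]^o) :
  f \in bounded_seq <-> exists M : R[i], forall n, `|f n| <= M.
Proof.
have PF := @globally_properfilter _ [set: nat] 0%N I.
rewrite inE; split=> [/(@ex_bound _ _ _ _ _ PF)[M fM]|[M fM]].
  by exists M => n; exact: fM.
by apply/(@ex_bound _ _ _ _ _ PF); exists M => n _; exact: fM.
Qed.

Fact bounded_seq_submod_closed : submod_closed bounded_seq.
Proof.
split=> [|a f g /bounded_seqP[M fM] /bounded_seqP[N gN]]; apply/bounded_seqP.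
  by exists 0 => n; rewrite normr0.
exists (`|a| * M + N) => n; rewrite !fctE.
by rewrite (le_trans (ler_normD _ _))// lerD// normrZ ler_wpM2l.
Qed.

HB.instance Definition _ :=
  GRing.isSubmodClosed.Build _ _ bounded_seq bounded_seq_submod_closed.
HB.instance Definition _ := [SubChoice_isSubLmodule of ell_infty by <:].

Definition sup_norm (f : ell_infty) : R := sup (range (fun n => rnorm (f n))).

Let sup_norm_has_sup (f : ell_infty) : has_sup (range (fun n => rnorm (f n))).
Proof.
split; first by exists (rnorm (f 0)), 0.
case: f => f /= /bounded_seqP[M fM]; exists (rnorm (M : R[i]^o)) => _ [n _ <-].
rewrite -lecR -!rnormE (le_trans (fM n))//.
by rewrite real_ler_norm// ger0_real// (le_trans _ (fM n)).
Qed.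

Let sup_norm_ub (f : ell_infty) n : rnorm (f n) <= sup_norm f.
Proof. by apply: sup_upper_bound => //; exists n. Qed.

Let sup_norm_le (f : ell_infty) c :
  (forall n, rnorm (f n) <= c) -> sup_norm f <= c.
Proof.
by move=> fc; apply: ge_sup; [case: (sup_norm_has_sup f)|move=> _ [n _ <-]].
Qed.

Fact sup_normD (f g : ell_infty) :
  (sup_norm (f + g))%:C <= (sup_norm f)%:C + (sup_norm g)%:C.
Proof.
rewrite -rmorphD lecR; apply: sup_norm_le => n.
by rewrite (le_trans (rnormD _ _))// lerD.
Qed.

Let sup_normZ_le a (f : ell_infty) :
  sup_norm (a *: f) <= rnorm (a : R[i]^o) * sup_norm f.
Proof. by apply: sup_norm_le => n; rewrite rnormZ ler_wpM2l ?rnorm_ge0. Qed.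

Fact sup_normZ a (f : ell_infty) :
  (sup_norm (a *: f))%:C = `|a| * (sup_norm f)%:C.
Proof.
rewrite (rnormE (a : R[i]^o)) -rmorphM /=; congr (_%:C).
apply/eqP; rewrite eq_le sup_normZ_le /=.
have [->|a0] := eqVneq a 0.
  by rewrite rnorm0 mul0r (le_trans _ (sup_norm_ub _ 0)) ?rnorm_ge0.
have ra0 : 0 < rnorm (a : R[i]^o) by rewrite -ltcR -rnormE normr_gt0.
rewrite -ler_pdivlMl// -{1}(scalerK a0 f).
rewrite (le_trans (sup_normZ_le _ _))// ler_wpM2r//.
  by rewrite (le_trans _ (sup_norm_ub _ 0)) ?rnorm_ge0.
by rewrite -lecR fmorphV /= -!rnormE normfV.
Qed.

Fact sup_norm_eq0 (f : ell_infty) : (sup_norm f)%:C = 0 -> f = 0.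
Proof.
move=> /(@complexI R) f0; apply/val_inj/funext => n /=.
by apply: rnorm0_eq0; apply/eqP; rewrite eq_le rnorm_ge0 andbT -f0.
Qed.

HB.instance Definition _ :=
  Lmodule_isNormed.Build R[i] ell_infty sup_normD sup_normZ sup_norm_eq0.

End EllInfty.

Section EllOne.
Variable R : realType.

Definition summable_seq : {pred nat -> R[i]^o} :=
  mem [set f : nat -> R[i]^o | cvgn (series (fun n => rnorm (f n)))].

Record ell_one :=
  EllOne { ell_one_seq :> nat -> R[i]^o; _ : ell_one_seq \in summable_seq }.

HB.instance Definition _ := [isSub for ell_one_seq].
HB.instance Definition _ := [Choice of ell_one by <:].

Fact summable_seq_submod_closed : submod_closed summable_seq.
Proof.
split=> [|a f g].
  rewrite inE /=; under eq_fun do rewrite rnorm0.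
  suff -> : series (fun=> 0 : R) = cst 0 by exact: is_cvg_cst.
  by apply/funext => n; rewrite /series /= big1.
rewrite !inE /= => fs gs.
apply: (@series_le_cvg _ _
  ((fun n => rnorm (a : R[i]^o) * rnorm (f n)) + (fun n => rnorm (g n)))).
- by move=> n; exact: rnorm_ge0.
- by move=> n; rewrite addr_ge0 ?mulr_ge0 ?rnorm_ge0.
- by move=> n; rewrite !fctE (le_trans (rnormD _ _))// rnormZ.
- by apply: is_cvg_seriesD => //; exact: is_cvg_seriesZ.
Qed.

HB.instance Definition _ :=
  GRing.isSubmodClosed.Build _ _ summable_seq summable_seq_submod_closed.
HB.instance Definition _ := [SubChoice_isSubLmodule of ell_one by <:].

Definition sum_norm (f : ell_one) : R :=
  limn (series (fun n => rnorm (f n))).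

Let sum_norm_cvg (f : ell_one) : cvgn (series (fun n => rnorm (f n))).
Proof. by case: f => f /= /[!inE]. Qed.

Fact sum_normD (f g : ell_one) :
  (sum_norm (f + g))%:C <= (sum_norm f)%:C + (sum_norm g)%:C.
Proof.
rewrite -rmorphD lecR /= /sum_norm -lim_seriesD//.
apply: lim_series_le => //; first exact: is_cvg_seriesD.
by move=> n; exact: rnormD.
Qed.

Fact sum_normZ a (f : ell_one) :
  (sum_norm (a *: f))%:C = `|a| * (sum_norm f)%:C.
Proof.
rewrite (rnormE (a : R[i]^o)) -rmorphM /=; congr (_%:C).
rewrite /sum_norm -[RHS]lim_seriesZ//; congr (limn (series _)).
by apply/funext => n; rewrite rnormZ.
Qed.

Fact sum_norm_eq0 (f : ell_one) : (sum_norm f)%:C = 0 -> f = 0.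
Proof.
move=> /(@complexI R) f0; apply/val_inj/funext => n /=.
apply: rnorm0_eq0; apply/eqP; rewrite eq_le rnorm_ge0 andbT -f0.
have ndf : nondecreasing_seq (series (fun n => rnorm (f n))).
  by apply: nondecreasing_series => k _ _; exact: rnorm_ge0.
apply: le_trans (nondecreasing_cvgn_le ndf (@sum_norm_cvg f) n.+1).
by rewrite seriesS lerDl// sumr_ge0// => k _; exact: rnorm_ge0.
Qed.

HB.instance Definition _ :=
  Lmodule_isNormed.Build R[i] ell_one sum_normD sum_normZ sum_norm_eq0.

End EllOne.

Section OperatorClasses.
Variable R : realType.
Implicit Types E F : normedModType R[i].

Definition unit_ball E : set E := [set x | `|x| <= 1].

Definition compact_op E F (T : op E F) := compact (closure (T @` @unit_ball E)).

(* The type E with its weak topology, the coarsest one which makes all the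
   bounded functionals on E continuous. *)
Definition weak E :=
  initial_topology (fun x : E => (fun phi => phi x) : {ptws dual E -> R[i]^o}).

HB.instance Definition _ E := Topological.on (weak E).

Definition weakly_compact_op E F (T : op E F) :=
  compact (closure (T @` @unit_ball E : set (weak F))).

Definition infinite_dimensional E :=
  ~ exists (n : nat) (v : 'I_n -> E),
      forall x, exists c : 'I_n -> R[i], x = \sum_(k < n) c k *: v k.

Definition very_few_operators E :=
  infinite_dimensional E /\
  forall T : op E E, exists (c : R[i]) (K : op E E),
    compact_op K /\ T = c *: op_id E + K.

Definition schauder_basis E (e : nat -> E) :=
  forall x : E, exists! a : nat -> R[i], series (fun k => a k *: e k) @ \oo --> x.

End OperatorClasses.

Section Ideals.
Variable A : pzRingType.
Implicit Types I J L : set A.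

Definition left_ideal L :=
  [/\ L 0, forall a b, L a -> L b -> L (a + b) & forall a b, L b -> L (a * b)].

Definition two_sided_ideal I :=
  left_ideal I /\ forall a b, I a -> I (a * b).

Definition maximal_among (P : set A -> Prop) I :=
  [/\ P I, I <> setT & forall J, P J -> I `<=` J -> J = I \/ J = setT].

Definition maximal_left_ideal := maximal_among left_ideal.

Definition maximal_two_sided_ideal := maximal_among two_sided_ideal.

Definition finitely_generated L :=
  exists2 G : {fset A}, G != fset0 &
    L = [set \sum_(t <- G) s t * t | s in [set: A -> A]].

End Ideals.

Definition fixed_ideal (R : realType) (E : normedModType R[i])
    (L : set (op E E)) :=
  exists2 x : E, x != 0 & L = [set T | T x = 0].

Section DirectSum.
Variables (R : realType) (X Y : normedModType R[i]).

Fact inl_subproof : (fun x : X => (x, 0 : Y)) \in bounded_linear X (X * Y)%type.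
Proof.
rewrite inE; split=> [a x y|].
  by apply: injective_projections; rewrite /= ?scaler0 ?addr0.
by exists 1 => x; rewrite mul1r prod_normE /= normr0 max_l.
Qed.

Fact inr_subproof : (fun y : Y => (0 : X, y)) \in bounded_linear Y (X * Y)%type.
Proof.
rewrite inE; split=> [a x y|].
  by apply: injective_projections; rewrite /= ?scaler0 ?addr0.
by exists 1 => x; rewrite mul1r prod_normE /= normr0 max_r.
Qed.

Fact fst_subproof : fst \in bounded_linear (X * Y)%type X.
Proof.
rewrite inE; split=> //; exists 1 => x; rewrite mul1r prod_normE.
by rewrite comparable_le_max ?lexx// real_comparable ?normr_real.
Qed.

Fact snd_subproof : snd \in bounded_linear (X * Y)%type Y.
Proof.
rewrite inE; split=> //; exists 1 => x; rewrite mul1r prod_normE.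
by rewrite comparable_le_max ?lexx ?orbT// real_comparable ?normr_real.
Qed.

Definition op_inl : op X (X * Y)%type := Op inl_subproof.
Definition op_inr : op Y (X * Y)%type := Op inr_subproof.
Definition op_fst : op (X * Y)%type X := Op fst_subproof.
Definition op_snd : op (X * Y)%type Y := Op snd_subproof.

Definition entry11 (T : op (X * Y)%type (X * Y)%type) : op X X :=
  op_comp op_fst (op_comp T op_inl).

Definition entry22 (T : op (X * Y)%type (X * Y)%type) : op Y Y :=
  op_comp op_snd (op_comp T op_inr).

End DirectSum.

Definition K1 (R : realType) (X Y : normedModType R[i]) :
  set (op (X * Y)%type (X * Y)%type) := [set T | compact_op (entry11 T)].

Definition W2 (R : realType) (X Y : normedModType R[i]) :
  set (op (X * Y)%type (X * Y)%type) := [set T | weakly_compact_op (entry22 T)].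

Arguments K1 {R} X Y.
Arguments W2 {R} X Y.

(* Main.v *)
Require Import Defs.
From HB Require Import structures.
From mathcomp Require Import all_boot all_order all_algebra finmap complex.
From mathcomp Require Import all_classical all_reals all_analysis.
From mathcomp Require Import ring lra.

(** Write X for X_AH and E for the direct sum of X and l_infty.

    As the dual of X is l_1, the bidual of X is l_infty, with canonical
    embedding U : X -> l_infty (bidual_embedding_of_dual_ell_one).
    Everything rests on the interplay of U with the injectivity of l_infty.
    Operators from X to l_infty extend to the bidual, i.e. factor through U
    (bidual_extension), and so do compact operators on X, with values in X
    (compact_bidual_extension). Hence an operator on E with compact (1, 1)
    entry is a left multiple of U, put in the (2, 1) corner, plus a left
    multiple of the second coordinate projection: K1 is generated by two
    elements.

    K1 is an ideal because an operator S T on X which factors through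
    l_infty is compact (factor_through_ell_infty_compact): if it were c + K
    with c nonzero and K compact, extending T and K to the bidual would
    produce a left inverse P of U. But X does not contain a complemented
    copy of l_infty, as it has very few operators
    (ell_infty_not_complemented); the projection U P, which factors through
    X, is therefore weakly compact, X is reflexive and P an isomorphism of
    l_infty onto X, a contradiction. Then K1 has codimension one, so it is a
    maximal left ideal.

    Conversely, let J be a non-fixed maximal left ideal with finitely many
    generators Psi i. Being non-fixed, J contains all operators of rank one
    (maximal_left_ideal_fixed). So every functional on E is dominated by the
    sum of the norms of the Psi i x, and a gliding hump argument shows that
    this sum dominates the norm of x (weakly_dominated). Thus the family Psi
    embeds E into a finite power of E, and by injectivity of l_infty every
    operator which factors through l_infty belongs to J. All the entries of
    an operator factor in this way, except for a multiple of the identity of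
    X in the (1, 1) entry; as J is proper, that multiple vanishes on J, and
    J is K1.

    What is used about weak compactness, here and for W2, is a dichotomy for
    an operator T on l_infty: either T is weakly compact or the identity of
    l_infty factors through T (weakly_compact_or_factor). Call T exhaustive
    if its semivariation tends to 0 along every disjoint sequence of subsets
    of nat. If T is not exhaustive, Rosenthal's lemma provides a copy of
    l_infty on which T is bounded below (factor_of_not_exhaustive). If T is
    exhaustive, it is controlled by the variations of finitely many of its
    coordinates, up to any given error (uniform_control), and the uniform
    convexity of L^2 for these variations makes T converge along the
    ultrafilters on the unit ball in the weak topology
    (exhaustive_weakly_compact). The dichotomy makes W2 a maximal ideal. It
    is contained in no fixed ideal, since the operators with values in X
    belong to it, and not in K1, since one of these is the projection onto
    X. *)

Import Order.TTheory GRing.Theory Num.Theory.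
Import numFieldNormedType.Exports.
Local Open Scope classical_set_scope.
Local Open Scope ring_scope.
Local Open Scope complex_scope.

Set Implicit Arguments.
Unset Strict Implicit.
Unset Printing Implicit Defensive.

(** * Linear functions and norms *)

Section LinearFunctions.
Variables (K : pzRingType) (V W : lmodType K) (f : V -> W).
Hypothesis fl : linear f.

Lemma linear_fD x y : f (x + y) = f x + f y.
Proof. by rewrite -[x in LHS]scale1r fl scale1r. Qed.

Lemma linear_f0 : f 0 = 0.
Proof. by apply: (addrI (f 0)); rewrite -linear_fD !addr0. Qed.

Lemma linear_fZ a x : f (a *: x) = a *: f x.
Proof. by rewrite -[_ *: _ in LHS]addr0 fl linear_f0 addr0. Qed.

Lemma linear_fN x : f (- x) = - f x.
Proof. by rewrite -scaleN1r linear_fZ scaleN1r. Qed.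

Lemma linear_fB x y : f (x - y) = f x - f y.
Proof. by rewrite linear_fD linear_fN. Qed.

Lemma linear_fsum (I : Type) (r : seq I) (P : pred I) (F : I -> V) :
  f (\sum_(i <- r | P i) F i) = \sum_(i <- r | P i) f (F i).
Proof.
by elim/big_rec2 : _ => [|i x y _ <-]; rewrite ?linear_f0 ?linear_fD.
Qed.

End LinearFunctions.

Section Rnorm.
Variable R : realType.
Notation C := (R[i]^o).

(** The tolerance e / (p + 1) replaces e / p, as p may be 0. *)
Lemma mul_div_lt (p e : R) : 0 <= p -> 0 < e -> p * (e / (p + 1)) < e.
Proof.
move=> p0 e0; have p1 : 0 < p + 1 by rewrite ltr_wpDl.
by rewrite mulrCA gtr_pMr// ltr_pdivrMr// mul1r ltrDl.
Qed.

Lemma rnormN (E : normedZmodType R[i]) (x : E) : rnorm (- x) = rnorm x.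
Proof. by rewrite /rnorm normrN. Qed.

Lemma rnormBC (E : normedZmodType R[i]) (x y : E) :
  rnorm (x - y) = rnorm (y - x).
Proof. by rewrite -rnormN opprB. Qed.

Lemma rnormB (E : normedZmodType R[i]) (x y : E) :
  rnorm (x - y) <= rnorm x + rnorm y.
Proof. by rewrite -(rnormN y) rnormD. Qed.

Lemma rnormB_trans (E : normedZmodType R[i]) (y x z : E) :
  rnorm (x - z) <= rnorm (x - y) + rnorm (y - z).
Proof. by rewrite -(subrKA y) rnormD. Qed.

Lemma rnorm_leB (E : normedZmodType R[i]) (x y : E) :
  rnorm x <= rnorm y + rnorm (x - y).
Proof. by rewrite -{1}(subrKC y x) rnormD. Qed.

Lemma rnorm_sum (E : normedZmodType R[i]) (I : Type) (r : seq I) (P : pred I)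
    (F : I -> E) :
  rnorm (\sum_(i <- r | P i) F i) <= \sum_(i <- r | P i) rnorm (F i).
Proof.
elim/big_ind2 : _ => [|x a y b xa yb|//]; first by rewrite rnorm0.
by rewrite (le_trans (rnormD _ _))// lerD.
Qed.

Lemma rnormM (a b : C) : rnorm (a * b : C) = rnorm a * rnorm b.
Proof. exact: (rnormZ a b). Qed.

Lemma rnormRC (r : R) : rnorm (r%:C : C) = `|r|.
Proof. by rewrite /rnorm normc_def /= expr0n /= addr0 sqrtr_sqr. Qed.

Lemma rnorm1 : rnorm (1 : C) = 1.
Proof. by rewrite -[1]/(1%:C) rnormRC normr1. Qed.

Lemma rnormV (a : C) : rnorm (a^-1 : C) = (rnorm a)^-1.
Proof.
have [->|a0] := eqVneq a 0; first by rewrite invr0 rnorm0 invr0.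
have na0 : rnorm a != 0 by apply: contra_neq a0; exact: rnorm0_eq0.
by apply: (mulIf na0); rewrite -rnormM !mulVf// rnorm1.
Qed.

Lemma rnorm_gt0 (E : normedZmodType R[i]) (x : E) : (0 < rnorm x) = (x != 0).
Proof.
rewrite lt_neqAle rnorm_ge0 andbT eq_sym; congr (~~ _).
by apply/eqP/eqP => [/rnorm0_eq0//|->]; exact: rnorm0.
Qed.

Lemma Re_le_rnorm (z : C) : complex.Re z <= rnorm z.
Proof.
rewrite /rnorm normc_def; case: z => a b /=.
rewrite (le_trans (ler_norm _))// -sqrtr_sqr ler_wsqrtr//.
by rewrite lerDl sqr_ge0.
Qed.

Lemma Im_le_rnorm (z : C) : complex.Im z <= rnorm z.
Proof.
rewrite /rnorm normc_def; case: z => a b /=.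
rewrite (le_trans (ler_norm _))// -sqrtr_sqr ler_wsqrtr//.
by rewrite lerDr sqr_ge0.
Qed.

Lemma unimodular_factor (z : C) :
  exists2 u : C, rnorm u = 1 & u * z = (rnorm z)%:C.
Proof.
have [->|z0] := eqVneq z 0.
  by exists 1; rewrite ?rnorm1// mul1r rnorm0.
have nz : rnorm z != 0 by apply: contra_neq z0; exact: rnorm0_eq0.
exists ((rnorm z)%:C / z); last by rewrite divfK.
by rewrite rnormM rnormV rnormRC ger0_norm ?rnorm_ge0// divff.
Qed.

Lemma rnorm_add_or_sub (E : normedModType R[i]) (u w : E) :
  rnorm (u + w) < rnorm w -> rnorm w <= rnorm (u - w).
Proof.
move=> small; have : rnorm (2%:C *: w) <= rnorm (u + w) + rnorm (u - w).
  have -> : 2%:C *: w = (u + w) - (u - w).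
    rewrite opprB addrC addrA subrK -[2]/(1 + 1) rmorphD rmorph1.
    by rewrite scalerDl scale1r.
  exact: rnormB.
rewrite rnormZ rnormRC ger0_norm//.
lra.
Qed.

End Rnorm.

(** * The Hahn-Banach theorem *)

Section RealHahnBanach.
Variables (R : realType) (V : lmodType R) (p : V -> R).
Hypothesis pD : forall x y, p (x + y) <= p x + p y.
Hypothesis pZ : forall r x, 0 <= r -> p (r *: x) = r * p x.

(** A linear functional on a subspace, encoded by its graph.  Domination makes
    the graph single-valued: (0, a) and (0, - a) are both in it if one is. *)
Definition dominated_graph (G : set (V * R)) :=
  [/\ G (0, 0),
      forall r u v, G u -> G v -> G (u.1 + r *: v.1, u.2 + r * v.2)
    & forall u, G u -> u.2 <= p u.1].

(** The value c at x0 has to lie between the numbers u.2 - p (u.1 - x0) and the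
    numbers p (v.1 + x0) - v.2; subadditivity of p makes room for it. *)
Lemma dominated_graph_extend (G : set (V * R)) (x0 : V) : dominated_graph G ->
  exists G', [/\ dominated_graph G', G `<=` G' & exists c, G' (x0, c)].
Proof.
move=> [G0 GD Gp].
pose A := [set u.2 - p (u.1 - x0) | u in G].
have Aub u v : G u -> G v -> u.2 - p (u.1 - x0) <= p (v.1 + x0) - v.2.
  move=> Gu Gv; have := Gp _ (GD 1 _ _ Gu Gv); rewrite scale1r mul1r /= => h.
  have := pD (u.1 - x0) (v.1 + x0); rewrite addrACA addNr addr0 => h2.
  lra.
have supA : has_sup A.
  split; first by exists (0 - p (0 - x0)), (0, 0).
  by exists (p (0 + x0) - 0) => _ [u Gu <-]; apply: (Aub u (0, 0)).
pose c := sup A.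
have cl u : G u -> u.2 - p (u.1 - x0) <= c.
  by move=> Gu; apply: sup_upper_bound => //; exists u.
have cr v : G v -> c <= p (v.1 + x0) - v.2.
  by move=> Gv; apply: ge_sup => [|_ [u Gu <-]]; [case: supA|exact: Aub].
have GZ r u : G u -> G (r *: u.1, r * u.2).
  by move=> Gu; have := GD r _ _ G0 Gu; rewrite !add0r.
exists [set w | exists u r, G u /\ w = (u.1 + r *: x0, u.2 + r * c)].
split; first split.
- by exists (0, 0), 0; split=> //; rewrite scale0r mul0r !addr0.
- move=> t _ _ [u [r [Gu ->]]] [v [s [Gv ->]]] /=.
  exists (u.1 + t *: v.1, u.2 + t * v.2), (r + t * s); split; first exact: GD.
  congr pair => /=.
    by rewrite scalerDr scalerDl scalerA addrACA.
  by ring.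
- move=> _ [u [r [Gu ->]]] /=.
  have [r0|r0|->] := ltgtP r 0.
  + have s0 : 0 < - r by rewrite oppr_gt0.
    have := cl _ (GZ (- r)^-1 _ Gu); rewrite /= => h.
    have -> : u.1 + r *: x0 = (- r) *: ((- r)^-1 *: u.1 - x0).
      by rewrite scalerBr scalerA divff ?gt_eqF// scale1r scaleNr opprK.
    rewrite (pZ _ (ltW s0)).
    have : (- r) * ((- r)^-1 * u.2 - p ((- r)^-1 *: u.1 - x0)) <= (- r) * c.
      by rewrite ler_pM2l.
    rewrite mulrBr mulrA divff ?gt_eqF// mul1r.
    lra.
  + have := cr _ (GZ r^-1 _ Gu); rewrite /= => h.
    have -> : u.1 + r *: x0 = r *: (r^-1 *: u.1 + x0).
      by rewrite scalerDr scalerA divff ?gt_eqF// scale1r.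
    rewrite (pZ _ (ltW r0)).
    have : r * c <= r * (p (r^-1 *: u.1 + x0) - r^-1 * u.2).
      by rewrite ler_pM2l.
    rewrite mulrBr mulrA divff ?gt_eqF// mul1r.
    lra.
  + by rewrite scale0r mul0r !addr0; apply: Gp.
- by move=> u Gu; exists u, 0; rewrite scale0r mul0r !addr0; case: u Gu.
- by exists c, (0, 0), 1; rewrite scale1r mul1r !add0r.
Qed.

Lemma real_hahn_banach (G0 : set (V * R)) : dominated_graph G0 ->
  exists h : V -> R, [/\ forall r x y, h (x + r *: y) = h x + r * h y,
    forall u, G0 u -> h u.1 = u.2 & forall x, h x <= p x].
Proof.
move=> dG0.
have p0 : p 0 = 0 by rewrite -(scale0r 0) pZ// mul0r.
(* The union with G0 lets Zorn's lemma handle the empty chain. *)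
have [|G [dG maxG]] := @Zorn_bigcup _ [set G | dominated_graph (G0 `|` G)].
  move=> F FP totF.
  have common u v : (G0 `|` \bigcup_(X in F) X) u ->
      (G0 `|` \bigcup_(X in F) X) v -> exists Y, [/\ dominated_graph (G0 `|` Y),
      (G0 `|` Y) u, (G0 `|` Y) v & (Y `<=` \bigcup_(X in F) X)].
    move=> [u0|[X FX Xu]] [v0|[Y FY Yv]].
    - by exists set0; rewrite setU0; split.
    - by exists Y; split; [exact: FP|left|right|exact: bigcup_sup].
    - by exists X; split; [exact: FP|right|left|exact: bigcup_sup].
    - have [XY|YX] := totF _ _ FX FY.
        exists Y; split; [exact: FP|right; exact: XY|by right|].
        exact: bigcup_sup.
      exists X; split; [exact: FP|by right|right; exact: YX|].
      exact: bigcup_sup.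
  case: dG0 => G00 _ _; split; first by left.
    move=> r u v /common /[apply] -[Y [[_ YD _] Yu Yv YF]].
    by case: (YD r _ _ Yu Yv) => [?|/YF ?]; [left|right].
  by move=> u Gu; have [Y [[_ _ Yp] Yu _ _]] := common _ _ Gu Gu; exact: Yp.
set H := G0 `|` G in dG.
have [H0 HD Hp] := dG.
have Huniq x a b : H (x, a) -> H (x, b) -> a = b.
  suff le a' b' : H (x, a') -> H (x, b') -> a' <= b'.
    by move=> ? ?; apply/eqP; rewrite eq_le !le.
  move=> ha hb; have := Hp _ (HD (-1) _ _ ha hb) => /=.
  by rewrite scaleN1r subrr p0 mulN1r subr_le0.
have Htot x : exists c, H (x, c).
  have [G' [dG' HG' [c G'c]]] := dominated_graph_extend x dG.
  apply: contrapT => nH; apply: (maxG G').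
    split=> [u Gu|G'G]; first by apply: HG'; right.
    by apply: nH; exists c; right; exact: G'G.
  by rewrite /= (_ : G0 `|` G' = G')//; apply/setUidPr => u ?; apply: HG'; left.
have /choice[h hH] := Htot.
exists h; split=> [r x y|[x a] G0u|x]; last exact: (Hp _ (hH x)).
  exact: (Huniq _ _ _ (hH _) (HD r _ _ (hH x) (hH y))).
by apply: (Huniq _ _ _ (hH _)); left.
Qed.

End RealHahnBanach.

Section ComplexHahnBanach.
Variable R : realType.
Notation C := (R[i]^o).

(** A copy of V which carries the module structure over R; on V itself it would
    compete with the one over R[i]. *)
Definition realified (V : lmodType R[i]) : Type := V.

Section Realified.
Variable V : lmodType R[i].
HB.instance Definition _ := GRing.Zmodule.on (realified V).

Let rscale (r : R) (x : realified V) : realified V := r%:C *: (x : V).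

Fact rscaleA a b v : rscale a (rscale b v) = rscale (a * b) v.
Proof. by rewrite /rscale scalerA rmorphM. Qed.
Fact rscale1 : left_id 1 rscale.
Proof. by move=> x; rewrite /rscale rmorph1 scale1r. Qed.
Fact rscaleDr : right_distributive rscale +%R.
Proof. by move=> a x y; exact: scalerDr. Qed.
Fact rscaleDl v : {morph rscale^~ v : a b / a + b}.
Proof. by move=> a b; rewrite /rscale rmorphD scalerDl. Qed.
HB.instance Definition _ := GRing.Zmodule_isLmodule.Build R (realified V)
  rscaleA rscale1 rscaleDr rscaleDl.

Lemma realified_scaleE (r : R) (x : V) : r *: (x : realified V) = r%:C *: x.
Proof. by []. Qed.
End Realified.

(** The functional to extend lives on a space W mapped to V by j; the bound by p
    makes it well defined on the image of j. *)
Lemma hahn_banach (V W : lmodType R[i]) (p : V -> R) (j : W -> V) (g : W -> C) :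
  (forall x y, p (x + y) <= p x + p y) ->
  (forall (a : C) x, p (a *: x) = rnorm a * p x) ->
  linear j -> linear g -> (forall w, rnorm (g w) <= p (j w)) ->
  exists h : V -> C, [/\ linear h, forall w, h (j w) = g w
    & forall x, rnorm (h x) <= p x].
Proof.
move=> pD pZ jl gl gp.
pose G0 := [set u : realified V * R | exists w, u = (j w, complex.Re (g w))].
have [jD jZ j0] := And3 (linear_fD jl) (linear_fZ jl) (linear_f0 jl).
have [gD gZ g0] := And3 (linear_fD gl) (linear_fZ gl) (linear_f0 gl).
have [|r x r0||h [hl hG0 hp]] := @real_hahn_banach R (realified V) p _ _ G0.
- exact: pD.
- by rewrite realified_scaleE pZ rnormRC ger0_norm.
- split.
  + by exists 0; rewrite j0 g0.
  + move=> r _ _ [v ->] [w ->]; exists (v + r%:C *: w).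
    rewrite jD gD jZ gZ realified_scaleE /=; congr (_, _).
    rewrite raddfD /=; congr (_ + _).
    by case: (g w) => a b /=; rewrite mul0r subr0.
  + by move=> _ [w ->] /=; rewrite (le_trans (Re_le_rnorm _)).
have hD x y : h (x + y) = h x + h y.
  by have := hl 1 x y; rewrite scale1r mul1r.
have h0 : h 0 = 0 by apply: (addrI (h 0)); rewrite -hD !addr0.
have hZ (r : R) (x : V) : h (r%:C *: x) = r * h x.
  by have := hl r 0 x; rewrite h0 !add0r realified_scaleE.
have hN (x : V) : h (- x) = - h x.
  by apply/eqP; rewrite -addr_eq0 -hD addNr h0.
(* The complex functional with real part h. *)
pose H (x : V) : C := h x +i* (- h ('i *: x)).
have HD x y : H (x + y) = H x + H y.
  by rewrite /H hD scalerDr hD opprD.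
have HZ a x : H (a *: x) = a * H x.
  case: a => a b.
  have -> : (a +i* b) *: x = a%:C *: x + b%:C *: ('i *: x).
    rewrite scalerA -scalerDl; congr (_ *: _).
    apply/eqP; rewrite eq_complex /= !mul0r !mulr1 !mulr0 !subr0 !addr0 add0r.
    by rewrite !eqxx.
  have hiZ (c : R) (y : V) : h ('i *: (c%:C *: y)) = c * h ('i *: y).
    by rewrite scalerA mulrC -scalerA hZ.
  have iiN : 'i *: ('i *: x) = - x by rewrite scalerA -expr2 sqr_i scaleN1r.
  rewrite /H scalerDr !hD !hiZ !hZ iiN hN; apply/eqP; rewrite eq_complex /=.
  by apply/andP; split; apply/eqP; ring.
exists H; split=> [a x y|w|x].
- by rewrite HD HZ.
- apply/eqP; rewrite eq_complex /=; apply/andP; split; apply/eqP.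
    exact: (hG0 _ (ex_intro _ w erefl)).
  rewrite -jZ (hG0 _ (ex_intro _ ('i *: w) erefl)) /= gZ.
  by case: (g w) => a b /=; rewrite mul0r mul1r sub0r opprK.
(* Rotating x turns H x into its modulus, which is then a value of h. *)
- have [u u1 uH] := unimodular_factor (H x).
  have : H (u *: x) = (rnorm (H x))%:C by rewrite HZ.
  move=> /(congr1 (@complex.Re R)) /= <-.
  by rewrite (le_trans (hp _))// pZ u1 mul1r.
Qed.

End ComplexHahnBanach.

(** * Operators and the injectivity of l_infty *)

Section Operators.
Variable R : realType.
Notation C := (R[i]^o).
Implicit Types E F : normedModType R[i].

(** The generic lemmas on linear maps hide the coercion from operators to
    functions behind their canonical structures; these forms keep it. *)
Lemma op_fD E F (T : op E F) x y : T (x + y) = T x + T y.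
Proof. exact: (linear_fD (op_is_linear T)). Qed.

Lemma op_fZ E F (T : op E F) a x : T (a *: x) = a *: T x.
Proof. exact: (linear_fZ (op_is_linear T)). Qed.

Lemma op_fB E F (T : op E F) x y : T (x - y) = T x - T y.
Proof. exact: (linear_fB (op_is_linear T)). Qed.

Lemma op_f0 E F (T : op E F) : T 0 = 0.
Proof. exact: (linear_f0 (op_is_linear T)). Qed.

Lemma op_fsum E F (T : op E F) (I : Type) (r : seq I) (P : pred I)
    (x : I -> E) :
  T (\sum_(i <- r | P i) x i) = \sum_(i <- r | P i) T (x i).
Proof. exact: (linear_fsum (op_is_linear T)). Qed.

Lemma op_subE E F (S T : op E F) x : (S - T) x = S x - T x.
Proof. by []. Qed.

Lemma op_sumE E F (I : Type) (r : seq I) (P : pred I) (T : I -> op E F) x :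
  (\sum_(i <- r | P i) T i) x = \sum_(i <- r | P i) T i x.
Proof. by elim/big_rec2 : _ => // i y S _ <-. Qed.

Lemma ell_infty_sumE (I : Type) (r : seq I) (P : pred I)
    (f : I -> ell_infty R) n :
  (\sum_(i <- r | P i) f i) n = \sum_(i <- r | P i) f i n.
Proof. by elim/big_rec2 : _ => // i y S _ <-. Qed.

Lemma op_rnormE E F (T : op E F) : rnorm T = op_rnorm T.
Proof. by []. Qed.

Lemma op_rnorm_le E F (T : op E F) x : rnorm (T x) <= rnorm T * rnorm x.
Proof.
have [->|x0] := eqVneq x 0; first by rewrite linear0 !rnorm0 mulr0.
have nx : 0 < rnorm x by rewrite rnorm_gt0.
have nx1 : 0 <= (rnorm x)^-1 by rewrite invr_ge0 ltW.
rewrite -ler_pdivrMr// mulrC.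
have -> : (rnorm x)^-1 * rnorm (T x) = rnorm (T ((rnorm x)^-1%:C *: x)).
  by rewrite linearZ rnormZ rnormRC ger0_norm.
rewrite op_rnormE; apply: sup_upper_bound.
  split; first by exists (rnorm (T 0)), 0 => //=; rewrite normr0.
  have [M M0 TM] := op_bounded T.
  exists (rnorm (M : C)) => _ [y /= y1 <-].
  by rewrite -lecR -!rnormE (le_trans (TM y))// ger0_norm// ler_piMr.
exists ((rnorm x)^-1%:C *: x) => //=.
by rewrite rnormE rnormZ rnormRC ger0_norm// mulVf ?gt_eqF.
Qed.

Lemma unit_ballE E (x : E) : unit_ball x = (rnorm x <= 1).
Proof. by rewrite /unit_ball /= rnormE -(rmorph1 (real_complex R)) lecR. Qed.

Lemma op_rnorm_ub E F (T : op E F) (c : R) :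
  (forall x, rnorm x <= 1 -> rnorm (T x) <= c) -> rnorm T <= c.
Proof.
move=> Tc; rewrite op_rnormE; apply: ge_sup.
  by exists (rnorm (T 0)), 0 => //=; rewrite normr0.
by move=> _ [x x1 <-]; apply: Tc; rewrite -unit_ballE.
Qed.

(** Operators are obtained from functions through this lemma; its bound is real,
    whereas the definition of operators has a complex one. *)
Lemma op_of_linear E F (f : E -> F) (M : R) : linear f ->
  (forall x, rnorm (f x) <= M * rnorm x) -> exists T : op E F, T =1 f.
Proof.
move=> fl fM; have fb : f \in bounded_linear E F.
  rewrite inE; split=> //; exists M%:C => x.
  by rewrite !rnormE -rmorphM lecR.
by exists (Op fb).
Qed.

Lemma ell_infty_le (f : ell_infty R) n : rnorm (f n) <= rnorm f.
Proof.
rewrite -[rnorm f]/(sup_norm f); apply: sup_upper_bound; last by exists n.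
split; first by exists (rnorm (f 0)), 0%N.
have PF := @globally_properfilter _ [set: nat] 0%N I.
case: f => f /= /[!inE] /(@ex_bound _ _ _ _ _ PF)[M fM].
exists (rnorm (M : C)) => _ [k _ <-]; rewrite -lecR -!rnormE.
rewrite (le_trans (fM k I))// real_ler_norm// ger0_real//.
by rewrite (le_trans _ (fM k I)).
Qed.

Lemma ell_infty_ub (f : ell_infty R) (c : R) :
  (forall n, rnorm (f n) <= c) -> rnorm f <= c.
Proof.
move=> fc; rewrite -[rnorm f]/(sup_norm f); apply: ge_sup.
  by exists (rnorm (f 0)), 0%N.
by move=> _ [n _ <-].
Qed.

Lemma ell_infty_of (g : nat -> C) (c : R) :
  (forall n, rnorm (g n) <= c) -> exists f : ell_infty R, f =1 g.
Proof.
move=> gc; have gb : g \in @bounded_seq R.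
  have PF := @globally_properfilter _ [set: nat] 0%N I.
  rewrite inE; apply/(@ex_bound _ _ _ _ _ PF); exists c%:C => n _.
  by rewrite /= rnormE lecR.
by exists (EllInfty gb).
Qed.

Lemma ell_infty_ext (f g : ell_infty R) : f =1 g -> f = g.
Proof. by move=> fg; apply/val_inj/funext. Qed.

Lemma coord_subproof n :
  (fun f : ell_infty R => f n : C) \in bounded_linear _ _.
Proof.
rewrite inE; split=> //; exists 1 => f; rewrite mul1r.
by rewrite !rnormE lecR ell_infty_le.
Qed.

Definition coord n : dual (ell_infty R) := Op (coord_subproof n).

Lemma op_ell_infty E (h : nat -> E -> C) (M : R) : (forall n, linear (h n)) ->
  (forall n x, rnorm (h n x) <= M * rnorm x) ->
  exists T : op E (ell_infty R), forall x n, T x n = h n x.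
Proof.
move=> hl hM.
have /choice[f fh] x : exists f : ell_infty R, f =1 h^~ x.
  by apply: (@ell_infty_of _ (M * rnorm x)) => n.
have [|x|T Tf] := @op_of_linear _ _ f M.
- move=> a x y; apply: ell_infty_ext => n; rewrite /= fh hl.
  by rewrite -!fh.
- by apply: ell_infty_ub => n; rewrite fh.
by exists T => x n; rewrite Tf fh.
Qed.

(** The Hahn-Banach theorem on the line through x. *)
Lemma norming_functional E (x : E) :
  exists chi : dual E,
    (forall y, rnorm (chi y) <= rnorm y) /\ chi x = (rnorm x)%:C.
Proof.
have [|||||h [hl hx hE]] := @hahn_banach R E C (fun x => rnorm x)
    (fun a : C => a *: x) (fun a : C => a * (rnorm x)%:C).
- exact: rnormD.
- exact: rnormZ.
- by move=> a b c; rewrite scalerDl scalerA.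
- by move=> a b c; rewrite mulrDl -mulrA.
- by move=> a; rewrite !rnormZ rnormRC ger0_norm ?rnorm_ge0.
have [|chi chih] := @op_of_linear E C h 1 hl; first by move=> y; rewrite mul1r.
exists chi; split=> [y|]; rewrite chih//.
by have := hx 1; rewrite scale1r mul1r.
Qed.

Lemma dual_separates E (x y : E) :
  (forall phi : dual E, phi x = phi y) -> x = y.
Proof.
move=> xy; have [chi [_]] := norming_functional (x - y).
rewrite linearB /= xy subrr => /(congr1 (@complex.Re R))/= /esym.
by move/rnorm0_eq0/eqP; rewrite subr_eq0 => /eqP.
Qed.

(** l_infty is injective.  A jointly bounded below family Psi embeds E into a
    finite power of F, and each coordinate of T extends from the image by the
    Hahn-Banach theorem, with a bound that is the same for all coordinates. *)
Lemma ell_infty_injective E F n (Psi : 'I_n -> op E F) (c : R)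
    (T : op E (ell_infty R)) :
  (forall x, rnorm x <= c * \sum_i rnorm (Psi i x)) ->
  exists S : 'I_n -> op F (ell_infty R), T = \sum_i op_comp (S i) (Psi i).
Proof.
move=> Psic.
have c0 : 0 <= rnorm T * `|c| by rewrite mulr_ge0 ?rnorm_ge0.
pose p (v : {ffun 'I_n -> F}) := rnorm T * `|c| * \sum_i rnorm (v i).
have /choice[h hP] k : exists h : {ffun 'I_n -> F} -> C, [/\ linear h,
    forall x, h [ffun i => Psi i x] = T x k & forall v, rnorm (h v) <= p v].
  apply: (@hahn_banach R _ E p (fun x => [ffun i => Psi i x])).
  - move=> v w; rewrite /p -mulrDr ler_wpM2l// -big_split ler_sum// => i _.
    by rewrite ffunE rnormD.
  - move=> a v; rewrite /p mulrCA; congr (_ * _); rewrite mulr_sumr.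
    by apply: eq_bigr => i _; rewrite ffunE rnormZ.
  - by move=> a x y; apply/ffunP => i; rewrite !ffunE linearP.
  - by move=> a x y; rewrite linearP.
  - move=> x; rewrite (le_trans (ell_infty_le _ _))//.
    rewrite (le_trans (op_rnorm_le _ _))// /p -mulrA ler_wpM2l ?rnorm_ge0//.
    rewrite (le_trans (Psic x))//.
    under [in leRHS]eq_bigr do rewrite ffunE.
    by rewrite ler_wpM2r ?ler_norm// sumr_ge0// => i _; exact: rnorm_ge0.
pose d i (y : F) : {ffun 'I_n -> F} := [ffun j => if j == i then y else 0].
have dl i : linear (d i).
  move=> a x y; apply/ffunP => j; rewrite !ffunE; case: eqP => // _.
  by rewrite scaler0 addr0.
have /choice[S SP] i : exists S : op F (ell_infty R),
    forall y k, S y k = h k (d i y).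
  apply: (@op_ell_infty F (fun k y => h k (d i y)) (rnorm T * `|c|)) => k.
    by move=> a x y; rewrite dl; have [-> _ _] := hP k.
  move=> y; have [_ _ hp] := hP k; rewrite (le_trans (hp _))// /p ler_wpM2l//.
  rewrite (bigD1 i)//= big1 ?addr0 ?ffunE ?eqxx// => j /negPf ji.
  by rewrite ffunE ji rnorm0.
exists S; apply: op_ext => x; apply: ell_infty_ext => k.
have [hl hT _] := hP k.
rewrite op_sumE ell_infty_sumE -hT.
have -> : [ffun i => Psi i x] = \sum_i d i (Psi i x).
  apply/ffunP => i; rewrite sum_ffunE ffunE (bigD1 i)//= big1.
    by rewrite addr0 ffunE eqxx.
  by move=> j /negPf ji; rewrite ffunE eq_sym ji.
by rewrite linear_fsum//; apply: eq_bigr => i _; rewrite SP.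
Qed.

End Operators.

(** * Relative compactness through ultrafilters *)

Section CompactImages.

(** In a regular space, relative compactness of an image is a statement about
    the ultrafilters on the source: an ultrafilter on the closure is tracked by
    one on the source, through the preimages of its open members. *)
Lemma compact_closure_imageP (T : Type) (F : topologicalType) (f : T -> F)
    (B : set T) : regular_space F ->
  compact (closure (f @` B)) <->
  forall U, UltraFilter U -> U B -> exists y : F, f @ U --> y.
Proof.
move=> regF; split=> [cB U uU UB|fU].
  have fUB : (f @ U) (closure (f @` B)).
    suff : U (f @^-1` closure (f @` B)) by [].
    by apply: filterS UB => x Bx; apply: subset_closure; exists x.
  have [y [_ cly]] := cB _ _ fUB.
  exists y => A /= Ay; have [//|UA] := in_ultra_setVsetC (f @^-1` A) uU.
  by have [z [/= nAz Az]] := cly (~` A) A UA Ay.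
rewrite compact_ultra => V uV VB /=.
(* The trace on B of the open members of V; they meet f @` B because they meet
   its closure. *)
pose G := filter_from [set W | open W /\ V W] (fun W => B `&` f @^-1` W).
have GP : ProperFilter G.
  apply: filter_from_proper; first apply: filter_from_filter.
  - by exists setT; split; [exact: openT|exact: filterT].
  - move=> W1 W2 [oW1 VW1] [oW2 VW2]; exists (W1 `&` W2).
      by split; [exact: openI|exact: filterI].
    by move=> x [Bx [? ?]].
  - move=> W [oW VW]; have [z [cz Wz]] := filter_ex (filterI VB VW).
    have [_ [[x Bx <-] Wx]] := cz W (open_nbhs_nbhs (conj oW Wz)).
    by exists x.
have [U [uU GU]] := ultraFilterLemma GP.
have UB : U B.
  apply: GU; exists setT; first by split; [exact: openT|exact: filterT].
  by move=> x [].
have [y fUy] := fU U uU UB.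
(* A closed neighbourhood of y outside V would have a complement in V, whose
   preimage is in U. *)
have Vy : V --> y.
  move=> N /regF [A Ay clA]; apply: filterS clA _.
  have [//|VC] := in_ultra_setVsetC (closure A) uV.
  have UnA : U (f @^-1` ~` closure A).
    apply: GU; exists (~` closure A); last by move=> x [].
    by split=> //; apply/closed_openC/closed_closure.
  have [x [/= nclA Ax]] := filter_ex (filterI UnA (fUy A Ay)).
  by case: nclA; exact: subset_closure.
exists y; split=> //; apply: (@closed_cvg _ _ V _ id) => //.
exact: closed_closure.
Qed.

Lemma initial_regular (S : choiceType) (T : topologicalType) (f : S -> T) :
  regular_space T -> regular_space (initial_topology f).
Proof.
move=> regT x A [_ [[W oW <-] Wx WA]].
have [B Bx clB] := regT _ _ (open_nbhs_nbhs (conj oW Wx)).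
have cf := @initial_continuous _ _ f.
exists (f @^-1` B); first exact: cf.
move=> y By; apply: WA; apply: clB => N /cf /By[z [Bz Nz]].
by exists (f z).
Qed.

Variable R : realType.
Notation C := (R[i]^o).
Implicit Types E F : normedModType R[i].

Lemma cvg_rnormP E (T : Type) (U : set_system T) (f : T -> E) (y : E) :
  Filter U ->
  f @ U --> y <-> forall e : R, 0 < e -> U [set x | rnorm (y - f x) < e].
Proof.
move=> FU; split=> [/cvgrPdist_lt fy e e0|fy].
  have := fy e%:C; rewrite ltcR => /(_ e0).
  by apply: filterS => x; rewrite rnormE ltcR.
apply/cvgrPdist_lt => e e0.
have er : e = (complex.Re e)%:C by rewrite RRe_real// gtr0_real.
have := fy (complex.Re e); rewrite -ltcR -er => /(_ e0).
by apply: filterS => x; rewrite /= rnormE er ltcR.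
Qed.

Lemma compact_opP E F (T : op E F) : compact_op T <->
  forall U, UltraFilter U -> U (@unit_ball R E) -> exists y : F, T @ U --> y.
Proof. exact/compact_closure_imageP/uniform_regular. Qed.

Lemma cvg_weakP E (U : set_system E) (y : E) : Filter U ->
  U --> (y : weak E) <-> forall phi : dual E, phi @ U --> phi y.
Proof.
move=> FU.
pose j (x : E) : {ptws dual E -> C} := fun phi => phi x.
split=> [Uy phi|Uy].
  have : j @ U --> j y.
    by move=> A /(@initial_continuous _ _ j y) /Uy.
  by move/pointwise_cvgP => /(_ phi).
have jU : j @ U --> j y by apply/pointwise_cvgP.
by move=> A [_ [[W oW <-] Wy WA]]; apply: filterS WA _; apply: jU;
  exact: open_nbhs_nbhs.
Qed.

Lemma weakly_compact_opP E F (T : op E F) : weakly_compact_op T <->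
  forall U, UltraFilter U -> U (@unit_ball R E) ->
    exists y, forall phi : dual F, phi \o T @ U --> phi y.
Proof.
have reg : regular_space (weak F).
  by apply: initial_regular; exact: uniform_regular.
rewrite /weakly_compact_op; split=> [/compact_closure_imageP TU U uU UB|TU].
  have [y Ty] := TU reg U uU UB; exists y => phi.
  by rewrite fmap_comp; move: phi; apply/cvg_weakP.
apply/compact_closure_imageP => // U uU UB.
have [y Ty] := TU U uU UB; exists y; apply/cvg_weakP => phi.
by rewrite -fmap_comp.
Qed.

End CompactImages.

(** * Limits along ultrafilters *)

Section UltraLimits.
Variable R : realType.
Notation C := (R[i]^o).
Implicit Types E F G : normedModType R[i].

Lemma rnorm_le_ReIm (z : C) : rnorm z <= `|complex.Re z| + `|complex.Im z|.
Proof.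
rewrite /rnorm normc_def; case: z => a b /=.
rewrite -[leRHS]ger0_norm ?addr_ge0// -sqrtr_sqr ler_wsqrtr// sqrrD.
rewrite !real_normK ?num_real//.
by rewrite lerD2r lerDl mulrn_wge0// mulr_ge0.
Qed.

Lemma ultra_fmap (I J : Type) (U : set_system I) (f : I -> J) :
  UltraFilter U -> UltraFilter (f @ U).
Proof.
move=> uU; split; first exact: fmap_proper_filter.
move=> G GP UG; apply/seteqP; split=> [A GA|A UA]; last exact: UG.
have [//|UnA] := in_ultra_setVsetC (f @^-1` A) uU.
have GnA : G (~` A) by exact: UG.
by have [x [/= nAx Ax]] := filter_ex (filterI GnA GA).
Qed.

Lemma compact_ultra_cvg (I : Type) (F : topologicalType) (A : set F)
    (U : set_system I) (f : I -> F) :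
  UltraFilter U -> compact A -> U (f @^-1` A) -> exists y : F, f @ U --> y.
Proof.
move=> uU; rewrite compact_ultra => cA UA.
by have [y [_ fy]] := cA _ (ultra_fmap f uU) UA; exists y.
Qed.

Lemma exists_ultra_oo : exists U : set_system nat, UltraFilter U /\ \oo `<=` U.
Proof. exact: ultraFilterLemma. Qed.

Section OneUltrafilter.
Variables (I : Type) (U : set_system I).
Hypothesis uU : UltraFilter U.

Lemma ultra_cvg_scalar (g : I -> C) (r : R) :
  U [set i | rnorm (g i) <= r] -> exists z : C, g @ U --> z.
Proof.
move=> Ur.
have real (h : I -> R) : U [set i | `|h i| <= r] -> exists z : R, h @ U --> z.
  move=> hr; apply: (compact_ultra_cvg uU (@segment_compact R (- r) r)).
  by apply: filterS hr => i /=; rewrite in_itv /= -ler_norml.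
have [|a ga] := real (fun i => complex.Re (g i)).
  apply: filterS Ur => i /= gr; rewrite ler_norml lerNl.
  rewrite (le_trans (Re_le_rnorm _) gr) andbT.
  by have := Re_le_rnorm (- g i); rewrite rnormN raddfN => /le_trans; apply.
have [|b gb] := real (fun i => complex.Im (g i)).
  apply: filterS Ur => i /= gr; rewrite ler_norml lerNl.
  rewrite (le_trans (Im_le_rnorm _) gr) andbT.
  by have := Im_le_rnorm (- g i); rewrite rnormN raddfN => /le_trans; apply.
exists (a +i* b); apply/cvg_rnormP => e e0.
have e2 : 0 < e / 2 by rewrite divr_gt0.
have /cvgrPdist_lt/(_ _ e2) Ua := ga; have /cvgrPdist_lt/(_ _ e2) Ub := gb.
apply: filterS (filterI Ua Ub) => i [/= ai bi].
rewrite (le_lt_trans (rnorm_le_ReIm _))// (splitr e) ltrD//.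
  by case: (g i) ai.
by case: (g i) bi.
Qed.

Lemma op_cvg E F (T : op E F) (f : I -> E) (x : E) :
  f @ U --> x -> T \o f @ U --> T x.
Proof.
move=> /cvg_rnormP fx; apply/cvg_rnormP => e e0.
have M0 : 0 < rnorm T + 1 by rewrite ltr_pwDr// rnorm_ge0.
have := fx (e / (rnorm T + 1)); rewrite divr_gt0// => /(_ isT).
apply: filterS => i /= xf; rewrite -linearB /=.
rewrite (le_lt_trans (op_rnorm_le _ _))//.
rewrite (@le_lt_trans _ _ ((rnorm T + 1) * rnorm (x - f i)))//.
  by rewrite ler_wpM2r ?rnorm_ge0// lerDl.
by rewrite mulrC -ltr_pdivlMr.
Qed.

Lemma cvg_rnorm_le E (f : I -> E) (x : E) (r : R) :
  f @ U --> x -> U [set i | rnorm (f i) <= r] -> rnorm x <= r.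
Proof.
move=> /cvg_rnormP fx fr; apply/ler_addgt0Pr => e e0.
have [i /= [xi fi]] := filter_ex (filterI (fx e e0) fr).
by rewrite (le_trans (rnorm_leB x (f i)))// lerD// ltW.
Qed.

Lemma cvg_rnorm_unique E (f : I -> E) (x y : E) :
  f @ U --> x -> f @ U --> y -> x = y.
Proof.
by apply: cvg_unique; exact: norm_hausdorff.
Qed.

(** Rescaling brings a bounded family into the unit ball, to which the
    compactness of an operator refers. *)
Lemma bounded_family_scaling E (f : I -> E) (r : R) :
  U [set i | rnorm (f i) <= r] ->
  exists2 s : R, s != 0 & ((fun i => s^-1%:C *: f i) @ U) (@unit_ball R E).
Proof.
move=> Ufr; pose s : R := `|r| + 1; have s0 : 0 < s by rewrite ltr_pwDr.
exists s; first by rewrite gt_eqF.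
change (U [set i | unit_ball (s^-1%:C *: f i)]); apply: filterS Ufr => i /= fr.
rewrite unit_ballE rnormZ rnormRC ger0_norm; last by rewrite invr_ge0 ltW.
rewrite ler_pdivrMl// mulr1 (le_trans fr)// /s.
by rewrite (le_trans (ler_norm r))// lerDl.
Qed.

Lemma compact_op_ultra E F (T : op E F) (f : I -> E) (r : R) :
  compact_op T -> U [set i | rnorm (f i) <= r] ->
  exists y : F, T \o f @ U --> y.
Proof.
move=> /compact_opP cT /bounded_family_scaling[s s0 Us].
have [y Ty] := cT _ (ultra_fmap _ uU) Us.
exists (s%:C *: y).
have -> : T \o f = (fun i => s%:C *: T (s^-1%:C *: f i)).
  apply/funext => i /=; rewrite linearZ scalerA -rmorphM /= divff//.
  by rewrite scale1r.
exact: cvgZl_tmp.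
Qed.

Lemma weakly_compact_op_ultra E F (T : op E F) (f : I -> E) (r : R) :
  weakly_compact_op T -> U [set i | rnorm (f i) <= r] ->
  exists y : F, forall phi : dual F, phi \o T \o f @ U --> phi y.
Proof.
move=> /weakly_compact_opP cT /bounded_family_scaling[s s0 Us].
have [y Ty] := cT _ (ultra_fmap _ uU) Us.
exists (s%:C *: y) => phi.
have -> : phi \o T \o f = (fun i => s%:C *: phi (T (s^-1%:C *: f i))).
  apply/funext => i /=; rewrite -!op_fZ scalerA -rmorphM /= divff//.
  by rewrite scale1r.
rewrite op_fZ; apply: cvgZl_tmp; exact: Ty.
Qed.

End OneUltrafilter.

Lemma ball_image_bounded E F (T : op E F) (U : set_system E) : Filter U ->
  U (@unit_ball R E) -> U [set x | rnorm (T x) <= rnorm T].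
Proof.
move=> FU; apply: filterS => x; rewrite unit_ballE /= => x1.
by rewrite (le_trans (op_rnorm_le T x))// ler_piMr// rnorm_ge0.
Qed.

Lemma compact_op0 E F : compact_op (0 : op E F).
Proof. by apply/compact_opP => U uU _; exists 0; exact: cvg_cst. Qed.

Lemma compact_opD E F (S T : op E F) :
  compact_op S -> compact_op T -> compact_op (S + T).
Proof.
move=> /compact_opP cS /compact_opP cT; apply/compact_opP => U uU UB.
have [y Sy] := cS U uU UB; have [z Tz] := cT U uU UB.
by exists (y + z); apply: cvgD.
Qed.

Lemma compact_op_compl E F G (S : op F G) (T : op E F) :
  compact_op T -> compact_op (op_comp S T).
Proof.
move=> /compact_opP cT; apply/compact_opP => U uU UB.
by have [y Ty] := cT U uU UB; exists (S y); apply: op_cvg.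
Qed.

Lemma compact_op_compr E F G (S : op F G) (T : op E F) :
  compact_op S -> compact_op (op_comp S T).
Proof.
move=> cS; apply/compact_opP => U uU UB.
apply: (compact_op_ultra uU (f := T) (r := rnorm T) cS).
exact: (ball_image_bounded T).
Qed.

Lemma weakly_compact_op0 E F : weakly_compact_op (0 : op E F).
Proof.
by apply/weakly_compact_opP => U uU _; exists 0 => phi; exact: cvg_cst.
Qed.

Lemma weakly_compact_opD E F (S T : op E F) :
  weakly_compact_op S -> weakly_compact_op T -> weakly_compact_op (S + T).
Proof.
move=> /weakly_compact_opP cS /weakly_compact_opP cT.
apply/weakly_compact_opP => U uU UB.
have [y Sy] := cS U uU UB; have [z Tz] := cT U uU UB.
exists (y + z) => phi; rewrite op_fD.
have -> : phi \o (S + T) = (phi \o S) + (phi \o T).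
  by apply/funext => x; exact: op_fD.
exact: cvgD.
Qed.

Lemma weakly_compact_op_compl E F G (S : op F G) (T : op E F) :
  weakly_compact_op T -> weakly_compact_op (op_comp S T).
Proof.
move=> /weakly_compact_opP cT; apply/weakly_compact_opP => U uU UB.
have [y Ty] := cT U uU UB; exists (S y) => phi.
exact: (Ty (op_comp phi S)).
Qed.

Lemma weakly_compact_op_compr E F G (S : op F G) (T : op E F) :
  weakly_compact_op S -> weakly_compact_op (op_comp S T).
Proof.
move=> cS; apply/weakly_compact_opP => U uU UB.
apply: (weakly_compact_op_ultra uU (f := T) (r := rnorm T) cS).
exact: (ball_image_bounded T).
Qed.

End UltraLimits.

(** * The duality between l_1 and l_infty *)

Section EllOneDuality.
Variable R : realType.
Notation C := (R[i]^o).

Lemma ell_one_cvg (a : ell_one R) : cvgn (series (fun n => rnorm (a n))).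
Proof. by case: a => a /= /[!inE]. Qed.

Lemma ell_one_partial_le (a : ell_one R) N :
  \sum_(n < N) rnorm (a n) <= rnorm a.
Proof.
rewrite -[rnorm a]/(sum_norm a).
have nd : nondecreasing_seq (series (fun n => rnorm (a n))).
  by apply: nondecreasing_series => k _ _; exact: rnorm_ge0.
have := nondecreasing_cvgn_le nd (@ell_one_cvg a) N.
by rewrite /series /= big_mkord.
Qed.

Lemma ell_one_ub (a : ell_one R) (c : R) :
  (forall N, \sum_(n < N) rnorm (a n) <= c) -> rnorm a <= c.
Proof.
move=> ac; rewrite -[rnorm a]/(sum_norm a).
apply: limr_le; first exact: ell_one_cvg.
by apply: nearW => N; rewrite /series /= big_mkord.
Qed.

Lemma ell_one_of (g : nat -> C) (c : R) :
  (forall N, \sum_(n < N) rnorm (g n) <= c) -> exists a : ell_one R, a =1 g.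
Proof.
move=> gc; have gs : g \in @summable_seq R.
  rewrite inE /=; apply: nondecreasing_is_cvgn.
    by apply: nondecreasing_series => k _ _; exact: rnorm_ge0.
  by exists c => _ [N _ <-]; rewrite /series /= big_mkord.
by exists (EllOne gs).
Qed.

Lemma ell_one_sumE (I : Type) (r : seq I) (P : pred I) (f : I -> ell_one R) n :
  (\sum_(i <- r | P i) f i) n = \sum_(i <- r | P i) f i n.
Proof. by elim/big_rec2 : _ => // i y S _ <-. Qed.

Lemma ell_one_tail (a : ell_one R) (e : R) : 0 < e ->
  exists m, forall N, \sum_(m <= n < N) rnorm (a n) <= e.
Proof.
move=> e0; have /cvgrPdist_lt/(_ _ e0)[m _ /(_ m (leqnn m))] := @ell_one_cvg a.
rewrite -[limn _]/(sum_norm a) /series /= => am; exists m => N.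
have [Nm|mN] := leqP N m; first by rewrite big_geq// ltW.
have aN := ell_one_partial_le a N; rewrite -[rnorm a]/(sum_norm a) in aN.
have : sum_norm a - \sum_(0 <= n < m) rnorm (a n) <= e.
  by rewrite (le_trans (ler_norm _))// ltW.
apply: le_trans; rewrite lerBrDl -big_cat_nat//=; last exact: ltnW.
by rewrite big_mkord.
Qed.

Lemma sum_kronecker N n :
  \sum_(k < N) rnorm (((k : nat) == n)%:R : C) <= 1.
Proof.
rewrite (eq_bigr (fun k : 'I_N => if (k : nat) == n then 1 else 0)); last first.
  by move=> k _; case: eqP => _; rewrite ?rnorm0 ?rnorm1.
have [nN|Nn] := ltnP n N; last first.
  by rewrite big1 ?ler01// => k _; rewrite ltn_eqF// (leq_trans (ltn_ord k)).
rewrite (bigD1 (Ordinal nN))//= eqxx big1 ?addr0// => k kn.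
by case: eqP => // kn'; case/eqP: kn; apply: val_inj.
Qed.

Lemma ell_one_unit_ex n : exists a : ell_one R, forall k, a k = (k == n)%:R.
Proof.
by apply: (@ell_one_of (fun k => (k == n)%:R) 1) => N; exact: sum_kronecker.
Qed.

Definition ell_one_unit n : ell_one R := sval (cid (ell_one_unit_ex n)).

Lemma ell_one_unitE n k : ell_one_unit n k = (k == n)%:R.
Proof. exact: (svalP (cid (ell_one_unit_ex n))). Qed.

Lemma ell_one_unit_norm n : rnorm (ell_one_unit n) <= 1.
Proof.
apply: ell_one_ub => N; under eq_bigr do rewrite ell_one_unitE.
exact: sum_kronecker.
Qed.

Lemma ell_one_comb_coord N (c : nat -> C) k :
  (\sum_(n < N) c n *: ell_one_unit n) k = if (k < N)%N then c k else 0.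
Proof.
rewrite ell_one_sumE; have [kN|Nk] := ltnP k N.
  rewrite (bigD1 (Ordinal kN))//= big1 => [|n nk].
    by rewrite addr0 -[LHS]/(c k * ell_one_unit k k) ell_one_unitE eqxx mulr1.
  rewrite -[LHS]/(c n * ell_one_unit n k) ell_one_unitE.
  by case: eqP => [kn|_]; [case/eqP: nk; apply: val_inj|rewrite mulr0].
rewrite big1// => n _; rewrite -[LHS]/(c n * ell_one_unit n k) ell_one_unitE.
by rewrite gtn_eqF ?mulr0// (leq_trans (ltn_ord n)).
Qed.

Lemma ell_one_comb_norm N (c : nat -> C) :
  \sum_(n < N) rnorm (c n) <= rnorm (\sum_(n < N) c n *: ell_one_unit n).
Proof.
apply: le_trans (ell_one_partial_le _ N); rewrite le_eqVlt; apply/orP; left.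
by apply/eqP/eq_bigr => n _; rewrite ell_one_comb_coord ltn_ord.
Qed.

Lemma ell_one_truncation (a : ell_one R) (e : R) : 0 < e ->
  exists m, forall N, (m <= N)%N ->
    rnorm (a - \sum_(n < N) a n *: ell_one_unit n) <= e.
Proof.
move=> e0; have [m am] := ell_one_tail a e0; exists m => N mN.
apply: ell_one_ub => K; apply: le_trans (am K).
set r := a - _.
have rE k : r k = if (k < N)%N then 0 else a k.
  rewrite -[LHS]/(a k - (\sum_(n < N) a n *: ell_one_unit n) k).
  by rewrite ell_one_comb_coord; case: ifP => _; rewrite ?subrr ?subr0.
have zero k : (k < N)%N -> rnorm (r k) = 0.
  by move=> kN; rewrite rE kN rnorm0.
rewrite -(big_mkord xpredT (fun k => rnorm (r k))).
have [Km|mK] := leqP K m.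
  rewrite (big_geq Km) big_nat_cond big1// => k; rewrite andbT => /andP[_ kK].
  by rewrite zero// (leq_trans kK)// (leq_trans Km).
rewrite (big_cat_nat _ (ltnW mK))//= big_nat_cond big1 ?add0r; last first.
  by move=> k; rewrite andbT => /andP[_ km]; rewrite zero// (leq_trans km).
apply: ler_sum => k _; rewrite -[X in rnorm X <= _]/(r k).
by rewrite rE; case: ifP => _; rewrite ?rnorm0 ?rnorm_ge0.
Qed.

(** The sum of a n * f n, as the limit of its partial sums along an ultrafilter,
    where it exists by boundedness.  The last clause is weak* continuity on
    bounded sets: f counts through finitely many coordinates, up to e. *)
Lemma ell_one_pairing (U : set_system nat) : UltraFilter U ->
  exists L : ell_one R -> dual (ell_infty R),
    [/\ forall (a : ell_one R) (f : ell_infty R),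
          (fun N => \sum_(n < N) a n * f n : C) @ U --> L a f,
        forall a f, rnorm (L a f) <= rnorm a * rnorm f
      & forall a e, 0 < e -> exists m, forall f : ell_infty R,
          rnorm (L a f) <=
            \sum_(n < m) rnorm (a n) * rnorm (f n) + e * rnorm f].
Proof.
move=> uU.
have bnd (a : ell_one R) (f : ell_infty R) N :
    rnorm (\sum_(n < N) a n * f n : C) <= rnorm a * rnorm f.
  rewrite (le_trans (rnorm_sum _ _ _))//.
  rewrite (@le_trans _ _ (\sum_(n < N) rnorm (a n) * rnorm f))//.
    apply: ler_sum => n _.
    by rewrite rnormM ler_wpM2l ?rnorm_ge0// ell_infty_le.
  by rewrite -mulr_suml ler_wpM2r ?rnorm_ge0// ell_one_partial_le.
have /choice[l lP] (af : ell_one R * ell_infty R) :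
    exists z : C, (fun N => \sum_(n < N) af.1 n * af.2 n : C) @ U --> z.
  apply: (ultra_cvg_scalar uU (r := rnorm af.1 * rnorm af.2)).
  by apply: filterE => N; exact: bnd.
have /choice[L LP] a : exists T : dual (ell_infty R), forall f, T f = l (a, f).
  have [||T Tl] :=
    @op_of_linear R (ell_infty R) C (fun f => l (a, f)) (rnorm a).
  - move=> c f g; apply: (cvg_rnorm_unique uU (lP (a, c *: f + g))).
    have -> : (fun N => \sum_(n < N) a n * (c *: f + g) n : C) =
      (fun N => c *: (\sum_(n < N) a n * f n) + \sum_(n < N) a n * g n).
      apply/funext => N; rewrite scaler_sumr -big_split; apply: eq_bigr => n _.
      change (a n * (c * f n + g n) = c * (a n * f n) + a n * g n).
      by rewrite mulrDr mulrCA.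
    by apply: cvgD; [apply: cvgZl_tmp; exact: (lP (a, f))|exact: (lP (a, g))].
  - move=> f; apply: (cvg_rnorm_le uU (lP (a, f))).
    by apply: filterE => N; exact: bnd.
  by exists T.
exists L; split=> [a f|a f|a e e0].
- by rewrite LP; exact: (lP (a, f)).
- rewrite LP; apply: (cvg_rnorm_le uU (lP (a, f))).
  by apply: filterE => N; exact: bnd.
have [m am] := ell_one_tail a e0; exists m => f; rewrite LP.
apply: (cvg_rnorm_le uU (lP (a, f))); apply: filterE => N /=.
rewrite (le_trans (rnorm_sum _ _ _))//.
rewrite (@le_trans _ _ (\sum_(n < N) rnorm (a n) * rnorm (f n)))//.
  by apply: ler_sum => n _; rewrite -(rnormM (a n) (f n)).
set F := fun n => rnorm (a n) * rnorm (f n).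
have F0 n : 0 <= F n by rewrite mulr_ge0 ?rnorm_ge0.
rewrite -!(big_mkord xpredT F).
rewrite (@le_trans _ _ (\sum_(0 <= n < m) F n + \sum_(m <= n < N) F n))//.
  have [Nm|mN] := leqP N m.
    rewrite (big_geq Nm) addr0 (big_cat_nat _ Nm)//= lerDl.
    by apply: sumr_ge0.
  by rewrite -big_cat_nat//= ltnW.
rewrite lerD2l (@le_trans _ _ (\sum_(m <= n < N) rnorm (a n) * rnorm f))//.
  by apply: ler_sum => n _; rewrite ler_wpM2l ?rnorm_ge0// ell_infty_le.
by rewrite -mulr_suml ler_wpM2r ?rnorm_ge0.
Qed.

End EllOneDuality.

(** * The embedding of a predual of l_1 into its bidual l_infty *)

Section BidualEmbedding.
Variable R : realType.
Notation C := (R[i]^o).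

(** When the dual of X is l_1, the bidual of X is l_infty.  Here U is the
    canonical embedding of X into it, and L psi is psi as a functional on the
    bidual.  The last field combines the two facts on biduals that are needed:
    the weak* density of the balls of X (Goldstine's theorem) and the weak*
    metrisability of the balls of the bidual, whence sequences. *)
Record bidual_embedding (X : normedModType R[i]) (U : op X (ell_infty R))
    (L : dual X -> dual (ell_infty R)) (M : R) : Prop := {
  bidual_bound : forall psi f, rnorm (L psi f) <= M * rnorm psi * rnorm f;
  bidual_extends : forall psi x, L psi (U x) = psi x;
  bidual_coord : forall n f, L (op_comp (coord R n) U) f = f n;
  bidual_goldstine : forall f, exists x : nat -> X,
    (forall N, rnorm (x N) <= M * rnorm f + 1) /\
    forall psi : dual X, psi \o x @ \oo --> L psi f }.

Section Helly.
Variables (X : normedModType R[i]) (phi : nat -> dual X) (M : R).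
Hypothesis phi_lower : forall N (c : nat -> C),
  (forall x, rnorm (\sum_(n < N) c n * phi n x) <= rnorm x) ->
  \sum_(n < N) rnorm (c n) <= M.

(** Helly: approximate interpolation with a norm bound.  Hahn-Banach is applied
    to the seminorm measuring how well, and at which cost, a sequence is
    interpolated on its first N terms. *)
Lemma helly (N : nat) (f : ell_infty R) (d : R) : 0 < d ->
  exists x, rnorm x <= M * rnorm f + 1 /\
    forall n, (n < N)%N -> rnorm (phi n x - f n) <= d.
Proof.
move=> d0.
have M0 : 0 <= M.
  have := phi_lower (N := 0) (c := fun=> 0).
  by rewrite !big_ord0; apply => x; rewrite big_ord0 rnorm0 rnorm_ge0.
pose B := (M * rnorm f + 1) / d.
have Mf0 : 0 <= M * rnorm f by rewrite mulr_ge0 ?rnorm_ge0.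
have B0 : 0 <= B by rewrite divr_ge0 ?ltW// ltr_wpDl.
(* B is the price of an interpolation error; at cost M * rnorm f + 1 the error
   is at most d. *)
pose cost (g : nat -> C) x := rnorm x + B * \sum_(n < N) rnorm (g n - phi n x).
have cost0 g x : 0 <= cost g x.
  rewrite addr_ge0 ?rnorm_ge0// mulr_ge0// sumr_ge0// => n _.
  exact: rnorm_ge0.
pose q g := inf (range (cost g)).
have qinf g : has_inf (range (cost g)).
  by split; [exists (cost g 0), 0|exists 0 => _ [x _ <-]].
have q_le g x : q g <= cost g x by apply: ge_inf; [case: (qinf g)|exists x].
have q_ge g c : (forall x, c <= cost g x) -> c <= q g.
  by move=> h; apply: lb_le_inf; [case: (qinf g)|move=> _ [x _ <-]].
have q_ge0 g : 0 <= q g by exact: q_ge.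
have costD g h x y : cost (g + h) (x + y) <= cost g x + cost h y.
  rewrite /cost addrACA lerD ?rnormD// -mulrDr ler_wpM2l// -big_split.
  apply: ler_sum => n _ /=; rewrite op_fD.
  by rewrite (le_trans _ (rnormD _ _))// opprD addrACA.
have costZ (a : C) g x : cost (a *: g) (a *: x) = rnorm a * cost g x.
  rewrite /cost rnormZ mulrDr; congr (_ + _).
  rewrite mulrCA; congr (_ * _); rewrite mulr_sumr; apply: eq_bigr => n _.
  by rewrite op_fZ -rnormZ scalerBr.
have qD g h : q (g + h) <= q g + q h.
  rewrite -lerBlDr; apply: (q_ge _ _) => x; rewrite lerBlDr -lerBlDl.
  apply: (q_ge _ _) => y; rewrite lerBlDl.
  by rewrite (le_trans (q_le _ (x + y))).
have qZ_le (a : C) g : q (a *: g) <= rnorm a * q g.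
  have [->|a0] := eqVneq a 0.
    rewrite rnorm0 mul0r scale0r (le_trans (q_le _ 0))// /cost rnorm0 add0r.
    by rewrite big1 ?mulr0// => n _; rewrite op_f0 subr0 rnorm0.
  have na0 : 0 < rnorm a by rewrite rnorm_gt0.
  rewrite -ler_pdivrMl//; apply: (q_ge _ _) => x; rewrite ler_pdivrMl// -costZ.
  exact: q_le.
have qZ (a : C) g : q (a *: g) = rnorm a * q g.
  apply/eqP; rewrite eq_le qZ_le /=; have [->|a0] := eqVneq a 0.
    by rewrite rnorm0 mul0r.
  have na0 : 0 < rnorm a by rewrite rnorm_gt0.
  rewrite -ler_pdivlMl// -rnormV -{1}(scalerK a0 g).
  exact: qZ_le.
have [|||h [hl hf hq]] := @hahn_banach R (nat -> C) C q
    (fun a => a *: (f : nat -> C)) (fun a => a * (q f)%:C) qD qZ.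
- by move=> a b c; rewrite scalerDl scalerA.
- by move=> a b c; rewrite mulrDl -mulrA.
- by move=> a; rewrite qZ rnormZ rnormRC ger0_norm.
pose e n : nat -> C := fun k => (k == n)%:R.
(* h only sees the first N terms, as the vector 0 interpolates a sequence that
   vanishes there at no cost. *)
have hE g : h g = \sum_(n < N) g n * h (e n).
  apply/eqP; rewrite -subr_eq0; apply/eqP/rnorm0_eq0/eqP.
  rewrite eq_le rnorm_ge0 andbT.
  have -> : h g - \sum_(n < N) g n * h (e n) = h (g - \sum_(n < N) g n *: e n).
    rewrite (linear_fB hl) (linear_fsum hl); congr (_ - _).
    by apply: eq_bigr => n _; rewrite (linear_fZ hl).
  rewrite (le_trans (hq _))// (le_trans (q_le _ 0))// /cost rnorm0 add0r.
  rewrite big1 ?mulr0// => n _; rewrite op_f0 subr0.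
  rewrite -[X in rnorm X]/(g n - (\sum_(k < N) g k *: e k) n).
  rewrite fct_sumE (bigD1 n)//= big1 => [|k kn].
    by rewrite addr0 -[X in _ - X]/(g n * (n == n)%:R) eqxx mulr1 subrr rnorm0.
  rewrite -[LHS]/(g k * ((n : nat) == k)%:R).
  by case: eqP => [nk|_]; [case/eqP: kn; apply: val_inj|rewrite mulr0].
(* On the values of x the cost of interpolation is at most rnorm x. *)
have cM : \sum_(n < N) rnorm (h (e n)) <= M.
  apply: (phi_lower (c := fun n => h (e n))) => x.
  pose g n : C := phi n x.
  have -> : \sum_(n < N) h (e n) * phi n x = h g.
    by rewrite hE; apply: eq_bigr => n _; rewrite mulrC.
  rewrite (le_trans (hq _))// (le_trans (q_le _ x))// /cost.
  rewrite big1 ?mulr0 ?addr0//.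
  by move=> n _; rewrite subrr rnorm0.
have qf : q f <= M * rnorm f.
  have := hf 1; rewrite scale1r mul1r => /(congr1 (fun z : C => rnorm z)).
  rewrite rnormRC ger0_norm// => <-.
  rewrite hE (le_trans (rnorm_sum _ _ _))//.
  rewrite (@le_trans _ _ (\sum_(n < N) rnorm (h (e n)) * rnorm f))//.
    apply: ler_sum => n _; rewrite rnormM mulrC ler_wpM2l ?rnorm_ge0//.
    exact: ell_infty_le.
  by rewrite -mulr_suml ler_wpM2r ?rnorm_ge0.
have [_ [x _ <-] xq] := inf_adherent ltr01 (qinf f).
have costx : cost f x <= M * rnorm f + 1.
  by rewrite ltW// (lt_le_trans xq)// lerD2r.
have S0 : 0 <= \sum_(n < N) rnorm (f n - phi n x).
  by apply: sumr_ge0 => n _; exact: rnorm_ge0.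
exists x; split=> [|n nN].
  by rewrite (le_trans _ costx)// /cost lerDl mulr_ge0.
rewrite rnormBC (le_trans (_ : _ <= \sum_(n < N) rnorm (f n - phi n x)))//.
  by rewrite (bigD1 (Ordinal nN))//= lerDl sumr_ge0// => k _; exact: rnorm_ge0.
have Bp : 0 < B by rewrite divr_gt0// ltr_wpDl.
rewrite -(ler_pM2l Bp).
have -> : B * d = M * rnorm f + 1 by rewrite /B divfK// gt_eqF.
by rewrite (le_trans _ costx)// /cost lerDr rnorm_ge0.
Qed.

End Helly.

(** The functionals phi n that correspond to the unit vectors of l_1 are the
    coordinates of U.  Every psi is the sum of (J psi) n * phi n, since J psi is
    the limit in l_1 of its truncations, and L psi f is the sum of
    (J psi) n * f n. *)
Lemma bidual_embedding_of_dual_ell_one (X : normedModType R[i]) :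
  isomorphic (dual X) (ell_one R) ->
  exists U L M, @bidual_embedding X U L M.
Proof.
move=> [J [J' [J'J JJ']]].
have JK psi : J' (J psi) = psi by rewrite -[LHS]/(op_comp J' J psi) J'J.
have J'K a : J (J' a) = a by rewrite -[LHS]/(op_comp J J' a) JJ'.
pose phi n : dual X := J' (ell_one_unit R n).
have [U0 [uU0 U0oo]] := exists_ultra_oo.
have [L [Llim Lbnd Ltail]] := @ell_one_pairing R _ uU0.
have [n|n x|U Uphi] := @op_ell_infty R X (fun n => phi n : X -> C) (rnorm J').
- exact: op_is_linear.
- rewrite (le_trans (op_rnorm_le _ _))// ler_wpM2r ?rnorm_ge0//.
  rewrite (le_trans (op_rnorm_le _ _))// ler_piMr ?rnorm_ge0//.
  exact: ell_one_unit_norm.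
exists U, (fun psi => L (J psi)), (rnorm J).
have ext psi x : L (J psi) (U x) = psi x.
  apply: (cvg_rnorm_unique uU0 (Llim _ _)).
  apply: (@cvg_trans _ ((fun N => \sum_(n < N) J psi n * U x n : C) @ \oo)).
    by move=> A /= ?; exact: U0oo.
  apply/cvg_rnormP => e e0.
  pose p := rnorm J' * rnorm x.
  have p0 : 0 <= p by rewrite mulr_ge0 ?rnorm_ge0.
  have [|m Jm] := @ell_one_truncation R (J psi) (e / (p + 1)).
    by rewrite divr_gt0// ltr_wpDl.
  exists m => // N /= /Jm {}Jm.
  have -> : psi x - \sum_(n < N) J psi n * U x n =
      J' (J psi - \sum_(n < N) J psi n *: ell_one_unit R n) x.
    rewrite op_fB JK op_subE op_fsum op_sumE; congr (_ - _).
    by apply: eq_bigr => n _; rewrite Uphi (op_fZ J') opZ.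
  rewrite (le_lt_trans _ (mul_div_lt p0 e0))// (le_trans (op_rnorm_le _ _))//.
  rewrite /p mulrAC ler_wpM2r ?rnorm_ge0// (le_trans (op_rnorm_le _ _))//.
  by rewrite ler_wpM2l ?rnorm_ge0.
have lower N (c : nat -> C) :
    (forall x, rnorm (\sum_(n < N) c n * phi n x : C) <= rnorm x) ->
    \sum_(n < N) rnorm (c n) <= rnorm J.
  move=> cphi; rewrite (le_trans (ell_one_comb_norm N c))//.
  rewrite -[X in rnorm X]J'K (le_trans (op_rnorm_le _ _))//.
  rewrite ler_piMr ?rnorm_ge0//; apply: op_rnorm_ub => x x1.
  rewrite op_fsum op_sumE; under eq_bigr do rewrite op_fZ.
  exact: le_trans (cphi x) x1.
split=> [psi f|||f].
- by rewrite (le_trans (Lbnd _ _))// ler_wpM2r ?rnorm_ge0// op_rnorm_le.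
- exact: ext.
- move=> n f; have -> : op_comp (coord R n) U = J' (ell_one_unit R n).
    by apply: op_ext => x; exact: Uphi.
  rewrite J'K; apply: (cvg_rnorm_unique uU0 (Llim _ _)).
  apply/cvg_rnormP => e e0; apply: U0oo; exists n.+1 => // N /= nN.
  rewrite (bigD1 (Ordinal nN))//= big1 => [|k kn].
    by rewrite ell_one_unitE eqxx mul1r addr0 subrr rnorm0.
  rewrite ell_one_unitE; case: eqP => [kn'|_]; last by rewrite mul0r.
  by case/eqP: kn; apply: val_inj.
have inv0 N : 0 < N.+1%:R^-1 :> R by rewrite invr_gt0.
have /choice[x xP] N := helly lower N f (inv0 N).
exists x; split=> [N|psi]; first by have [] := xP N.
pose K := rnorm U * (rnorm J * rnorm f + 1) + rnorm f + 1.
have K0 : 0 < K.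
  rewrite ltr_wpDl// addr_ge0 ?rnorm_ge0// mulr_ge0 ?rnorm_ge0//.
  by rewrite addr_ge0 ?mulr_ge0 ?rnorm_ge0.
have Kx N : rnorm (U (x N) - f) <= K.
  have [xN _] := xP N.
  rewrite (le_trans (rnormB _ _))// /K -[leLHS]addr0 lerD ?ler01// lerD2r.
  by rewrite (le_trans (op_rnorm_le _ _))// ler_wpM2l ?rnorm_ge0.
apply/cvg_rnormP => e e0.
have [|m Lm] := Ltail (J psi) (e / 2 / K); first by rewrite !divr_gt0.
have [m' m'P] : exists m', forall N, (m' <= N)%N ->
    rnorm (J psi) * N.+1%:R^-1 < e / 2.
  have e2 : 0 < e / 2 by rewrite divr_gt0.
  have r0 : 0 <= rnorm (J psi) / (e / 2) by rewrite divr_ge0 ?rnorm_ge0 ?ltW.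
  exists (Num.truncn (rnorm (J psi) / (e / 2))).+1 => N m'N.
  rewrite ltr_pdivrMr// -ltr_pdivrMl// mulrC.
  rewrite (lt_le_trans (truncnS_gt _))// ler_nat (leq_trans m'N)//.
exists (maxn m m') => // N /=; rewrite geq_max => /andP[mN /m'P JN].
have eK0 : 0 <= e / 2 / K by rewrite !divr_ge0 ?ltW.
rewrite -(ext psi (x N)) -op_fB (le_lt_trans (Lm _))// [ltRHS]splitr.
rewrite ltr_leD//; last first.
  rewrite (@le_trans _ _ (e / 2 / K * K))//.
    by rewrite ler_wpM2l// rnormBC.
  by rewrite divfK ?gt_eqF.
rewrite (le_lt_trans _ JN)//.
rewrite (@le_trans _ _ (\sum_(n < m) rnorm (J psi n) * N.+1%:R^-1))//.
  apply: ler_sum => n _; rewrite ler_wpM2l ?rnorm_ge0//.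
  rewrite -rnormN -[- _]/(- (f n - U (x N) n)) opprB Uphi.
  by have [_] := xP N; apply; rewrite (leq_trans (ltn_ord n)).
by rewrite -mulr_suml ler_wpM2r// ell_one_partial_le.
Qed.

End BidualEmbedding.

(** * Extensions to the bidual *)

Section BidualConsequences.
Variable R : realType.
Notation C := (R[i]^o).

Lemma compact_op_close (E F : normedModType R[i]) (K : op E F) (u : nat -> E)
    (r e : R) : compact_op K -> (forall n, rnorm (u n) <= r) -> 0 < e ->
  exists m n, (m < n)%N /\ rnorm (K (u m) - K (u n)) < e.
Proof.
move=> cK ur e0; have [U [uU Uoo]] := exists_ultra_oo.
have [|y] := compact_op_ultra (U := U) uU (f := u) (r := r) cK.
  by apply: filterE => n; exact: ur.
have e2 : 0 < e / 2 by rewrite divr_gt0.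
move=> /cvg_rnormP/(_ _ e2) Uy; have [m my] := filter_ex Uy.
have Um : U [set n | (m < n)%N] by apply: Uoo; exists m.+1.
have [n [/= ny mn]] := filter_ex (filterI Uy Um).
exists m, n; split=> //.
rewrite (le_lt_trans (rnormB_trans y _ _))// (splitr e).
by rewrite ltrD// rnormBC.
Qed.

Lemma ell_infty_unit_ex n : exists f : ell_infty R, forall k, f k = (k == n)%:R.
Proof.
apply: (@ell_infty_of R (fun k => (k == n)%:R) 1) => k.
by case: eqP => _; rewrite ?rnorm1// rnorm0.
Qed.

Definition ell_infty_unit n : ell_infty R := sval (cid (ell_infty_unit_ex n)).

Lemma ell_infty_unitE n k : ell_infty_unit n k = (k == n)%:R.
Proof. exact: (svalP (cid (ell_infty_unit_ex n))). Qed.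

Lemma ell_infty_unit_norm n : rnorm (ell_infty_unit n) <= 1.
Proof.
apply: ell_infty_ub => k; rewrite ell_infty_unitE.
by case: eqP => _; rewrite ?rnorm1// rnorm0.
Qed.

(** A compact operator has no eigenvalue of infinite multiplicity other than 0;
    here for eigenvectors among the unit vectors of l_infty. *)
Lemma compact_eigenvalue0 (E F : normedModType R[i]) (B : op (ell_infty R) E)
    (K : op E F) (A : op F (ell_infty R)) (s : nat -> nat) (a : C) :
  compact_op K -> injective s ->
  (forall n, A (K (B (ell_infty_unit (s n)))) = a *: ell_infty_unit (s n)) ->
  a = 0.
Proof.
move=> cK s_inj AKB; apply/rnorm0_eq0/eqP; rewrite eq_le rnorm_ge0 andbT.
apply/ler_addgt0Pr => e e0; rewrite add0r.
have [||m [n [mn mnK]]] := @compact_op_close _ _ K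
    (fun n => B (ell_infty_unit (s n))) (rnorm B) (e / (rnorm A + 1)) cK.
- move=> n; rewrite (le_trans (op_rnorm_le _ _))// ler_piMr ?rnorm_ge0//.
  exact: ell_infty_unit_norm.
- by rewrite divr_gt0// ltr_wpDl// rnorm_ge0.
have -> : rnorm a = rnorm ((A (K (B (ell_infty_unit (s m)))) -
    A (K (B (ell_infty_unit (s n))))) (s m)).
  rewrite !AKB -[X in _ = rnorm X]/(a * ell_infty_unit (s m) (s m) -
    a * ell_infty_unit (s n) (s m)) !ell_infty_unitE eqxx (inj_eq s_inj).
  by rewrite ltn_eqF// mulr1 mulr0 subr0.
rewrite (le_trans (ell_infty_le _ _))// -op_fB (le_trans (op_rnorm_le _ _))//.
rewrite ltW// (le_lt_trans _ (mul_div_lt (rnorm_ge0 A) e0))//.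
by rewrite ler_wpM2l ?rnorm_ge0// ltW.
Qed.

(** Were l_infty complemented in X, every operator on l_infty would be scalar
    plus compact; the projection onto the even coordinates is not. *)
Lemma ell_infty_not_complemented (X : normedModType R[i])
    (A : op X (ell_infty R)) (B : op (ell_infty R) X) :
  very_few_operators X -> op_comp A B <> op_id (ell_infty R).
Proof.
move=> [_ vfo] AB.
have ABf f : A (B f) = f by rewrite -[LHS]/(op_comp A B f) AB.
have [n c f g|n f|P Pf] := @op_ell_infty R (ell_infty R)
    (fun n f => if odd n then 0 else f n) 1.
- by case: odd => //; rewrite scaler0 addr0.
- by rewrite mul1r; case: odd; rewrite ?rnorm0 ?rnorm_ge0// ell_infty_le.
have [c [K [cK BPA]]] := vfo (op_comp B (op_comp P A)).
have AKB f : A (K (B f)) = P f - c *: f.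
  have -> : K (B f) = B (P (A (B f))) - c *: B f.
    rewrite -[B (P _)]/(op_comp B (op_comp P A) (B f)) BPA.
    by rewrite opD addrAC subrr add0r.
  by rewrite op_fB op_fZ !ABf.
have c1 : 1 - c = 0.
  apply: (@compact_eigenvalue0 _ _ B K A (fun n => n.*2)) => // [|n].
    by move=> m n /double_inj.
  rewrite AKB scalerBl scale1r; congr (_ - _); apply: ell_infty_ext => k.
  rewrite Pf ell_infty_unitE; case: ifP => // ok; case: eqP => // kn.
  by move: ok; rewrite kn odd_double.
have c0 : - c = 0.
  apply: (@compact_eigenvalue0 _ _ B K A (fun n => n.*2.+1)) => // [|n].
    by move=> m n [] /double_inj.
  rewrite AKB scaleNr -[RHS]add0r; congr (_ - _); apply: ell_infty_ext => k.
  rewrite Pf ell_infty_unitE; case: ifP => // ok; case: eqP => // kn.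
  by move: ok; rewrite kn /= odd_double.
by move/eqP: c1; rewrite c0 addr0 oner_eq0.
Qed.

Section Embedding.
Variables (X : normedModType R[i]) (U : op X (ell_infty R)).
Variables (L : dual X -> dual (ell_infty R)) (M : R).
Hypothesis UL : bidual_embedding U L M.

Lemma bidual_injective x : U x = 0 -> x = 0.
Proof.
move=> Ux; apply: dual_separates => phi.
by rewrite -(bidual_extends UL) Ux !op_f0.
Qed.

(** The second adjoint of an operator into l_infty, corrected by the canonical
    projection of the bidual of l_infty: an extension to the bidual. *)
Lemma bidual_extension (T : op X (ell_infty R)) :
  exists W : op (ell_infty R) (ell_infty R), op_comp W U = T.
Proof.
have [n|n f|W Wf] := @op_ell_infty R (ell_infty R)
    (fun n f => L (op_comp (coord R n) T) f) (`|M| * rnorm T).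
- exact: op_is_linear.
- rewrite (le_trans (bidual_bound UL _ _))// ler_wpM2r ?rnorm_ge0//.
  rewrite (@le_trans _ _ (`|M| * rnorm (op_comp (coord R n) T)))//.
    by rewrite ler_wpM2r ?rnorm_ge0// ler_norm.
  rewrite ler_wpM2l//; apply: op_rnorm_ub => x x1.
  rewrite (le_trans (ell_infty_le (T x) n))// (le_trans (op_rnorm_le _ _))//.
  by rewrite ler_piMr ?rnorm_ge0.
exists W; apply: op_ext => x; apply: ell_infty_ext => n.
by rewrite [LHS]Wf (bidual_extends UL).
Qed.

(** The values of the second adjoint of a compact operator are limits of images
    of bounded sequences, so they lie in the target itself. *)
Lemma compact_bidual_extension (Y : normedModType R[i]) (K : op X Y) :
  compact_op K -> exists V : op (ell_infty R) Y, op_comp V U = K /\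
    forall (psi : dual Y) f, psi (V f) = L (op_comp psi K) f.
Proof.
move=> cK; have [U0 [uU0 U0oo]] := exists_ultra_oo.
have /choice[v vP] f : exists y : Y, forall psi : dual Y,
    psi y = L (op_comp psi K) f.
  have [x [xM xf]] := bidual_goldstine UL f.
  have [|y Ky] := compact_op_ultra uU0 (f := x) (r := M * rnorm f + 1) cK.
    by apply: filterE => N; exact: xM.
  exists y => psi; apply: (cvg_rnorm_unique uU0 (op_cvg uU0 (T := psi) Ky)).
  by move=> A /(xf (op_comp psi K)) /U0oo.
have [c f g|f|V Vv] := @op_of_linear R (ell_infty R) Y v (`|M| * rnorm K).
- by apply: dual_separates => psi; rewrite op_fD op_fZ !vP op_fD op_fZ.
- have [chi [chi1 chiv]] := norming_functional (v f).
  have -> : rnorm (v f) = rnorm (chi (v f)).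
    by rewrite chiv rnormRC ger0_norm ?rnorm_ge0.
  rewrite vP (le_trans (bidual_bound UL _ _))// ler_wpM2r ?rnorm_ge0//.
  rewrite (@le_trans _ _ (`|M| * rnorm (op_comp chi K)))//.
    by rewrite ler_wpM2r ?rnorm_ge0// ler_norm.
  rewrite ler_wpM2l//; apply: op_rnorm_ub => x x1.
  rewrite (le_trans (chi1 _))// (le_trans (op_rnorm_le _ _))//.
  by rewrite ler_piMr ?rnorm_ge0.
exists V; split=> [|psi f]; last by rewrite Vv vP.
apply: op_ext => x; apply: dual_separates => psi.
by rewrite -[op_comp V U x]/(V (U x)) Vv vP (bidual_extends UL).
Qed.

(** If the identity of X were compact, its extension to the bidual would show
    that X is its own bidual l_infty. *)
Lemma op_id_not_compact : very_few_operators X -> ~ compact_op (op_id X).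
Proof.
move=> vfo cI; have [V [_ VL]] := compact_bidual_extension cI.
apply: (@ell_infty_not_complemented X U V vfo).
apply: op_ext => f; apply: ell_infty_ext => n.
rewrite -[LHS]/(op_comp (coord R n) U (V f)) VL -(bidual_coord UL n f).
by congr (L _ f); exact: op_ext.
Qed.

End Embedding.
End BidualConsequences.

(** * Exhaustive submeasures and Rosenthal's lemma *)

Section Submeasures.
Variable R : realType.

Definition submeasure (m : set nat -> R) :=
  [/\ m set0 = 0, forall A B, A `<=` B -> m A <= m B
    & forall A B, m (A `|` B) <= m A + m B].

(** A disjoint sequence of sets is encoded by a colouring of nat: its classes
    may be larger than the given sets, which monotonicity allows. *)
Definition exhaustive (m : set nat -> R) :=
  forall (c : nat -> nat) (e : R), 0 < e -> exists j, m (c @^-1` [set j]) <= e.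

Lemma submeasure_ge0 m A : submeasure m -> 0 <= m A.
Proof. by move=> [m0 mono _]; rewrite -m0; apply: mono. Qed.

Lemma submeasure_bigcup m (A : nat -> set nat) a b : submeasure m ->
  m [set x | exists i, (a <= i < b)%N /\ A i x] <= \sum_(a <= i < b) m (A i).
Proof.
move=> [m0 mono mU]; elim: b => [|b IH].
  rewrite big_geq// (_ : [set x | _] = set0) ?m0//.
  by apply/seteqP; split=> // x [i [/andP[_]]].
have [ab|ba] := leqP a b; last first.
  rewrite big_geq// (_ : [set x | _] = set0) ?m0//.
  apply/seteqP; split=> // x [i [/andP[ai ib] _]].
  by move: (leq_trans ba ai); rewrite ltnNge -ltnS ib.
rewrite big_nat_recr//= (le_trans _ (lerD IH (lexx _)))//.
apply: le_trans (mU _ _); apply: mono => x [i [/andP[ai]]].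
rewrite ltnS leq_eqVlt => /predU1P[->|ib] Ax; first by right.
by left; exists i; rewrite ai ib.
Qed.

(** An exhaustive submeasure sees only a bounded part of an increasing
    sequence: otherwise it would be large on infinitely many of its successive
    differences, which are disjoint. *)
Lemma exhaustive_cauchy m (F : nat -> set nat) (e : R) : submeasure m ->
  exhaustive m -> (forall i j, (i <= j)%N -> F i `<=` F j) -> 0 < e ->
  exists N, forall N', (N <= N')%N -> m (F N' `\` F N) <= e.
Proof.
move=> [_ mono _] exh Fincr e0; apply: contrapT => /forallNP h.
have /choice[next nextP] N : exists N', (N <= N')%N /\ e < m (F N' `\` F N).
  have /existsNP[N' /not_implyP[NN' /negP]] := h N.
  by rewrite -ltNge => mN; exists N'.
pose s j := iter j next 0%N.
have s_le i j : (i <= j)%N -> (s i <= s j)%N.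
  move=> /subnK <-; elim: (j - i)%N => // k IH.
  by rewrite addSn (leq_trans IH)//; have [] := nextP (s (k + i)%N).
pose D j := F (s j.+1) `\` F (s j).
have D_disj i j x : D i x -> D j x -> i = j.
  wlog ij : i j / (i < j)%N => [hw Di Dj|].
    have [ij|ji|//] := ltngtP i j; first exact: (hw i j).
    by apply/esym; exact: (hw j i).
  by move=> [Fi _] [_ /(_ (Fincr _ _ (s_le _ _ ij) _ Fi))].
(* Points outside all the D j are given the colour 0. *)
pose c x := if pselect (exists j, D j x) is left h then sval (cid h) else 0%N.
have [j mj] := exh c e e0.
have [_] := nextP (s j); rewrite ltNge => /negP; apply; apply: le_trans mj.
apply: mono => x Dx; rewrite /= /c.
case: pselect => [ex|]; last by case; exists j.
by case: (cid ex) => i Dix /=; exact: (D_disj _ _ x).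
Qed.

Lemma sum_half (p : nat) : \sum_(n < p) (2^-1 : R) ^+ n.+1 <= 1.
Proof.
suff -> : \sum_(n < p) (2^-1 : R) ^+ n.+1 = 1 - 2^-1 ^+ p.
  by rewrite gerBl exprn_ge0.
elim: p => [|p IH]; first by rewrite big_ord0 expr0 subrr.
by rewrite big_ord_recr /= IH exprS; field.
Qed.

Lemma sum_half_tail (a b : nat) :
  \sum_(a <= n < b) (2^-1 : R) ^+ n <= 2 * 2^-1 ^+ a.
Proof.
have [ba|/ltnW ab] := leqP b a; first by rewrite big_geq// mulr_ge0// exprn_ge0.
suff -> : \sum_(a <= n < b) (2^-1 : R) ^+ n = 2 * 2^-1 ^+ a - 2 * 2^-1 ^+ b.
  by rewrite gerBl mulr_ge0// exprn_ge0.
elim: b ab => [|b IH].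
  by rewrite leqn0 => /eqP ->; rewrite big_geq// subrr.
rewrite leq_eqVlt => /predU1P[->|]; first by rewrite big_geq// subrr.
by rewrite ltnS => ab; rewrite big_nat_recr//= IH// exprS; field.
Qed.

(** If the submeasures m k were not uniformly continuous with respect to finitely
    many of them, there would be sets E i, negligible for m k with k < i but not
    for their supremum eta.  Exhaustivity replaces the union of the E i with
    n <= i by a finite union G n, and the decreasing intersections H p of the
    G n become small for all m k at once; yet H p contains almost all of E i
    for large i. *)
Lemma uniform_control (eta : set nat -> R) (m : nat -> set nat -> R) (e : R) :
  submeasure eta -> (forall k, submeasure (m k)) ->
  (forall k A, m k A <= eta A) ->
  (forall A t, t < eta A -> exists k, t < m k A) ->
  exhaustive eta -> 0 < e ->
  exists N d, 0 < d /\
    forall A, (forall k, (k < N)%N -> m k A < d) -> eta A <= e.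
Proof.
move=> eta_sub m_sub m_le eta_sup exh e0; apply: contrapT => h.
have half0 n : 0 < (2^-1 : R) ^+ n by rewrite exprn_gt0.
have /choice[E EP] i : exists A, (forall k, (k < i)%N -> m k A < 2^-1 ^+ i) /\
    exists k, e < m k A.
  move/forallNP : h => /(_ i)/forallNP/(_ (2^-1 ^+ i))/not_andP[//|].
  move=> /existsNP[A /not_implyP[mA /negP]]; rewrite -ltNge => /eta_sup[k mk].
  by exists A; split=> //; exists k.
pose F n N := [set x | exists i, (n <= i < N)%N /\ E i x].
have F_incr n N N' : (N <= N')%N -> F n N `<=` F n N'.
  by move=> NN' x [i [/andP[ni iN] Eix]]; exists i; rewrite ni (leq_trans iN).
have /choice[S SP] n : exists N, forall N', (N <= N')%N ->
    eta (F n N' `\` F n N) <= e / 2 * 2^-1 ^+ n.+1.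
  apply: (exhaustive_cauchy eta_sub exh (F_incr n)).
  by rewrite mulr_gt0// divr_gt0.
pose G n := F n (S n).
pose H p := [set x | forall n, (n <= p)%N -> G n x].
have [p pP] : exists p, forall p', (p <= p')%N -> eta (H p `\` H p') <= e / 8.
  have [||p pP] := @exhaustive_cauchy eta (fun p => ~` H p) (e / 8) eta_sub exh.
  - move=> i j ij x nHi Hj; apply: nHi => n ni; apply: Hj.
    exact: leq_trans ij.
  - by rewrite divr_gt0.
  exists p => p' pp'; apply: le_trans (pP p' pp').
  by have [_ mono _] := eta_sub; apply: mono => x [Hp nHp']; split=> // /(_ Hp).
(* Each m k tends to 0 along H; exhaustivity makes this uniform in k. *)
have mH k : m k (H p) <= e / 4.
  have [m0 mono mU] := m_sub k.
  have [p' [pp' kp' p'e]] : exists p', [/\ (p <= p')%N, (k < p')%N &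
      2 * (2^-1 : R) ^+ p' <= e / 8].
    have e8 : 0 < e / 8 / 2 by rewrite !divr_gt0.
    have [N _ NP] := near_infty_natSinv_expn_lt (PosNum e8).
    exists (maxn p (maxn k.+1 N)); split; rewrite ?leq_maxl//.
      by rewrite (leq_trans _ (leq_maxr _ _))// leq_maxl.
    rewrite mulrC -ler_pdivlMr// exprVn -div1r ltW// NP//=.
    by rewrite (leq_trans _ (leq_maxr _ _))// leq_maxr.
  have Hpp' : H p `<=` (H p `\` H p') `|` H p'.
    by move=> x Hx; have [|] := pselect (H p' x); [right|left].
  rewrite (le_trans (mono _ _ Hpp'))// (le_trans (mU _ _))//.
  have -> : e / 4 = e / 8 + e / 8 by field.
  rewrite lerD ?(le_trans (m_le _ _) (pP _ pp'))//.
  rewrite (le_trans (mono _ (G p') _))//; first by move=> x; apply.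
  rewrite (le_trans (submeasure_bigcup _ _ _ (m_sub k)))//.
  apply: le_trans p'e; apply: le_trans (sum_half_tail p' (S p')).
  rewrite big_nat_cond [leRHS]big_nat_cond; apply: ler_sum => j.
  rewrite andbT => /andP[p'j _]; rewrite ltW//; have [+ _] := EP j; apply.
  exact: leq_trans p'j.
pose T := \max_(n < p.+1) S n.
pose i := maxn p T.
have [_ [k ek]] := EP i.
have [m0 mono mU] := m_sub k.
have EH : E i `<=` H p `|` [set x | exists n, (0 <= n < p.+1)%N /\
    (F n i.+1 `\` G n) x].
  move=> x Eix; have [Hx|] := pselect (H p x); [by left|].
  move=> /existsNP[n /not_implyP[np nG]]; right.
  exists n; split=> //; split=> //.
  exists i; split=> //; rewrite ltnSn andbT (leq_trans np)//.
  exact: leq_maxl.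
have : m k (E i) <= e / 4 + e / 2.
  rewrite (le_trans (mono _ _ EH))// (le_trans (mU _ _))// lerD//.
  rewrite (le_trans (submeasure_bigcup _ _ _ (m_sub k)))// big_mkord.
  rewrite (@le_trans _ _ (\sum_(n < p.+1) e / 2 * 2^-1 ^+ n.+1))//.
    apply: ler_sum => n _; rewrite (le_trans (m_le _ _))// SP//.
    rewrite (leq_trans _ (leqnSn _))// (leq_trans _ (leq_maxr _ _))//.
    exact: (leq_bigmax n).
  by rewrite -mulr_sumr ler_piMr ?sum_half// ltW// divr_gt0.
by rewrite leNgt => /negP; apply; apply: le_lt_trans ek; lra.
Qed.

(** Rosenthal's lemma.  Cut the indices into infinitely many infinite pieces
    t p.  If no piece will do, each of them has a bad index; the masses seen on
    the sequence of these bad indices are smaller by e than those on the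
    sequence one started from, which can happen only finitely often. *)
Lemma rosenthal (nu : nat -> set nat -> R) (v e : R) :
  (forall k A B, A `<=` B -> nu k A <= nu k B) ->
  (forall k A B, A `&` B = set0 -> nu k A + nu k B <= nu k (A `|` B)) ->
  (forall k A, 0 <= nu k A <= v) -> 0 < e ->
  exists s : nat -> nat, injective s /\
    forall k, nu (s k) (range s `\ s k) <= e.
Proof.
move=> mono add bnd e0.
suff main n (s0 : nat -> nat) : injective s0 ->
    (forall k, nu (s0 k) (range s0) <= n%:R * e) ->
    exists s : nat -> nat, injective s /\
      forall k, nu (s k) (range s `\ s k) <= e.
  have v0 : 0 <= v by have /andP[/le_trans] := bnd 0%N set0; apply.
  apply: (main (Num.truncn (v / e)).+1 id) => // k.
  have /andP[_ /le_trans] := bnd k (range id); apply.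
  by rewrite -ler_pdivrMr// ltW// truncnS_gt.
elim: n s0 => [|n IH] s0 s0_inj s0n.
  exists s0; split=> // k; rewrite (le_trans (mono _ _ (range s0) _))//.
  by rewrite (le_trans (s0n k))// mul0r ltW.
pose t (p i : nat) := s0 (choice.pickle (p, i)).
have t_inj p i q j : t p i = t q j -> p = q /\ i = j.
  by move=> /s0_inj /(pcan_inj choice.pickleK)[].
have [[p pP]|bad] := pselect (exists p, forall i,
    nu (t p i) (range (t p) `\ t p i) <= e).
  by exists (t p); split=> // i j /t_inj[].
have /choice[b bP] p : exists i, e < nu (t p i) (range (t p) `\ t p i).
  by move/forallNP : bad => /(_ p)/existsNP[i /negP]; rewrite -ltNge; exists i.
apply: (IH (fun p => t p (b p))) => [p q /t_inj[]//|p].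
set r := fun p => t p (b p).
have disj : range r `&` (range (t p) `\ t p (b p)) = set0.
  apply/seteqP; split=> // x [[q _ <-] [[i _ ti] ne]]; apply: ne => /=.
  by move: ti => /t_inj[<- _].
have := add (r p) _ _ disj => /le_trans /(_ (mono _ _ (range s0) _)) h.
have : nu (r p) (range r) + nu (r p) (range (t p) `\ t p (b p)) <= n.+1%:R * e.
  rewrite (le_trans (h _))//; last exact: s0n.
  by move=> x [[q _ <-]|[[i _ <-] _]]; exact: imageT.
rewrite -natr1 mulrDl mul1r => hh.
by rewrite -(lerD2r e) (le_trans _ hh)// lerD2l ltW//; exact: bP.
Qed.

End Submeasures.

(** * Semivariations *)

Section Semivariation.
Variable R : realType.
Notation C := (R[i]^o).
Notation linf := (ell_infty R).

Definition weight (g : nat -> R) :=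
  (forall n, 0 <= g n) /\ exists c, forall n, g n <= c.

(** For a functional T this is the integral of g against the total variation of
    the finitely additive measure that represents T. *)
Definition svar (Y : normedModType R[i]) (T : op linf Y) (g : nat -> R) : R :=
  sup [set rnorm (T h) | h in [set h : linf | forall n, rnorm (h n) <= g n]].

Definition ind (A : set nat) (n : nat) : R := (n \in A)%:R.

Lemma weight_ind A : weight (ind A).
Proof.
split=> [n|]; first exact: ler0n.
by exists 1 => n; rewrite /ind; case: (n \in A); rewrite ?lexx ?ler01.
Qed.

Section General.
Variables (Y : normedModType R[i]) (T : op linf Y).

Let svar_has_sup g : weight g ->
  has_sup
    [set rnorm (T h) | h in [set h : linf | forall n, rnorm (h n) <= g n]].
Proof.
move=> [g0 [c gc]]; split.
  by exists (rnorm (T 0)), 0 => // n; rewrite rnorm0.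
exists (rnorm T * c) => _ [h hg <-].
rewrite (le_trans (op_rnorm_le _ _))// ler_wpM2l ?rnorm_ge0//.
by apply: ell_infty_ub => n; exact: le_trans (hg n) (gc n).
Qed.

Lemma svar_ub g (h : linf) : weight g -> (forall n, rnorm (h n) <= g n) ->
  rnorm (T h) <= svar T g.
Proof.
by move=> gw hg; apply: sup_upper_bound; [exact: svar_has_sup|exists h].
Qed.

Lemma svar_le g c : weight g ->
  (forall h : linf, (forall n, rnorm (h n) <= g n) -> rnorm (T h) <= c) ->
  svar T g <= c.
Proof.
move=> gw hc; apply: ge_sup; first by case: (svar_has_sup gw).
by move=> _ [h hg <-]; exact: hc.
Qed.

Lemma svar_gt g c : weight g -> c < svar T g ->
  exists2 h : linf, (forall n, rnorm (h n) <= g n) & c < rnorm (T h).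
Proof.
move=> gw cg; apply: contrapT => nh; move: cg; rewrite ltNge => /negP; apply.
apply: svar_le => // h hg; rewrite leNgt; apply/negP => ch.
by apply: nh; exists h.
Qed.

Lemma svar_ge0 g : weight g -> 0 <= svar T g.
Proof.
move=> gw; rewrite -(rnorm0 Y) -(op_f0 T); apply: svar_ub => // n.
by rewrite rnorm0; case: gw.
Qed.

Lemma svar_mono g g' : weight g -> weight g' -> (forall n, g n <= g' n) ->
  svar T g <= svar T g'.
Proof.
move=> gw gw' gg'; apply: svar_le => // h hg; apply: svar_ub => // n.
exact: le_trans (hg n) (gg' n).
Qed.

Lemma svar_bound g c : weight g -> (forall n, g n <= c) ->
  svar T g <= rnorm T * c.
Proof.
move=> gw gc; apply: svar_le => // h hg.
rewrite (le_trans (op_rnorm_le _ _))// ler_wpM2l ?rnorm_ge0//.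
by apply: ell_infty_ub => n; exact: le_trans (hg n) (gc n).
Qed.

Lemma weightD g g' : weight g -> weight g' -> weight (fun n => g n + g' n).
Proof.
move=> [g0 [c gc]] [g0' [c' gc']]; split=> [n|]; first by rewrite addr_ge0.
by exists (c + c') => n; rewrite lerD.
Qed.

Lemma weightZ t g : 0 <= t -> weight g -> weight (fun n => t * g n).
Proof.
move=> t0 [g0 [c gc]]; split=> [n|]; first by rewrite mulr_ge0.
by exists (t * c) => n; rewrite ler_wpM2l.
Qed.

Lemma svarZ t g : 0 < t -> weight g ->
  svar T (fun n => t * g n) <= t * svar T g.
Proof.
move=> t0 gw; apply: svar_le => [|h hg].
  by apply: weightZ => //; exact: ltW.
rewrite mulrC -ler_pdivrMr// mulrC.
have -> : t^-1 * rnorm (T h) = rnorm (T (t^-1%:C *: h)).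
  by rewrite op_fZ rnormZ rnormRC ger0_norm// invr_ge0 ltW.
apply: svar_ub => // n.
rewrite -[X in rnorm X]/(t^-1%:C *: h n) rnormZ rnormRC ger0_norm; last first.
  by rewrite invr_ge0 ltW.
by rewrite mulrC ler_pdivrMr// mulrC.
Qed.

(** A function bounded by g + g' is divided in the proportion g : g'. *)
Lemma svarD g g' : weight g -> weight g' ->
  svar T (fun n => g n + g' n) <= svar T g + svar T g'.
Proof.
move=> gw gw'; apply: svar_le => [|h hg]; first exact: weightD.
have [g0 _] := gw; have [g0' _] := gw'.
have frac (a b z : R) : 0 <= a -> 0 <= b -> 0 <= z -> z <= a + b ->
    z * (a / (a + b)) <= a.
  move=> a0 b0 z0 zab; have [ab0|ab] := eqVneq (a + b) 0.
    by rewrite ab0 invr0 !mulr0.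
  have ab1 : 0 < a + b by rewrite lt_neqAle eq_sym ab addr_ge0.
  by rewrite mulrCA ler_piMr// ler_pdivrMr// mul1r.
have [h1 h1E] : exists h1 : linf, h1 =1 fun n => h n * (g n / (g n + g' n))%:C.
  have [_ [c gc]] := gw; apply: (@ell_infty_of R _ c) => n.
  rewrite rnormM rnormRC ger0_norm ?divr_ge0 ?addr_ge0//.
  by rewrite (le_trans (frac _ _ _ _ _ _ _))// rnorm_ge0.
have h1g n : rnorm (h1 n) <= g n.
  rewrite h1E rnormM rnormRC ger0_norm ?divr_ge0 ?addr_ge0// frac//.
  exact: rnorm_ge0.
have h2g n : rnorm ((h - h1) n) <= g' n.
  rewrite -[X in rnorm X]/(h n - h1 n) h1E.
  (* Where g + g' vanishes so does h; the quotient is 0 there by convention. *)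
  have [ab0|ab] := eqVneq (g n + g' n) 0.
    have /rnorm0_eq0 -> : rnorm (h n) = 0.
      by apply/eqP; rewrite eq_le rnorm_ge0 andbT -ab0.
    by rewrite mul0r subr0 rnorm0.
  have -> : h n - h n * (g n / (g n + g' n))%:C =
      h n * (g' n / (g' n + g n))%:C.
    rewrite -[X in X - _]mulr1 -mulrBr; congr (_ * _).
    rewrite -[1]/(1%:C) -rmorphB; congr (_%:C).
    by rewrite [g' n + _]addrC; field.
  rewrite rnormM rnormRC ger0_norm ?divr_ge0 ?addr_ge0// frac//.
    exact: rnorm_ge0.
  by rewrite addrC.
rewrite -(subrKC h1 h) op_fD (le_trans (rnormD _ _))// lerD// svar_ub//.
Qed.

Definition svarA (A : set nat) : R := svar T (ind A).

Lemma svarA_submeasure : submeasure svarA.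
Proof.
have w := weight_ind; split=> [|A B AB|A B].
- apply/eqP; rewrite eq_le svar_ge0// andbT.
  apply: svar_le => // h hg; have -> : h = 0.
    apply: ell_infty_ext => n; apply/rnorm0_eq0/eqP.
    rewrite eq_le rnorm_ge0 andbT (le_trans (hg n))// /ind.
    by rewrite memNset.
  by rewrite op_f0 rnorm0.
- apply: svar_mono => // n; rewrite /ind ler_nat.
  by case: (boolP (n \in A)) => // /set_mem/AB/mem_set ->.
- apply: le_trans (svarD (w A) (w B)); apply: svar_mono => //.
    exact: weightD.
  by move=> n; rewrite /ind -natrD ler_nat in_setU; do 2 case: (n \in _).
Qed.

End General.

(** Unimodular factors align the values of a functional on two functions. *)
Lemma svar_superadditive (mu : dual linf) g g' : weight g -> weight g' ->
  svar mu g + svar mu g' <= svar mu (fun n => g n + g' n).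
Proof.
move=> gw gw'; rewrite -lerBrDr; apply: svar_le => // h hg; rewrite lerBrDr.
rewrite -lerBrDl; apply: svar_le => // h' hg'; rewrite lerBrDl.
have [u u1 uh] := unimodular_factor (mu h).
have [v v1 vh] := unimodular_factor (mu h').
have -> : rnorm (mu h) + rnorm (mu h') = rnorm (mu (u *: h + v *: h')).
  rewrite op_fD !op_fZ -[_ *: mu h]/(u * mu h) -[_ *: mu h']/(v * mu h').
  by rewrite uh vh -rmorphD rnormRC ger0_norm// addr_ge0 ?rnorm_ge0.
apply: svar_ub => [|n]; first exact: weightD.
rewrite -[X in rnorm X]/(u *: h n + v *: h' n) (le_trans (rnormD _ _))//.
by rewrite !rnormZ u1 v1 !mul1r lerD.
Qed.

Lemma svarA_superadditive (mu : dual linf) A B : A `&` B = set0 ->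
  svarA mu A + svarA mu B <= svarA mu (A `|` B).
Proof.
move=> AB; have w := weight_ind.
apply: le_trans (svar_superadditive mu (w A) (w B)) _.
apply: svar_mono => //; first exact: weightD.
move=> n; rewrite /ind -natrD ler_nat in_setU.
case: (boolP (n \in A)) => // /set_mem An.
case: (boolP (n \in B)) => // /set_mem Bn.
by have : (A `&` B) n by []; rewrite AB.
Qed.

Section Coordinates.
Variable T : op linf linf.

Lemma svarA_coord_le k A : svarA (op_comp (coord R k) T) A <= svarA T A.
Proof.
apply: svar_le => [|h hA]; first exact: weight_ind.
apply: le_trans (ell_infty_le (T h) k) _.
by apply: svar_ub => //; exact: weight_ind.
Qed.

Lemma svarA_coord_sup A t : t < svarA T A ->
  exists k, t < svarA (op_comp (coord R k) T) A.
Proof.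
move=> /svar_gt[|h hA tT]; first exact: weight_ind.
have [k tk] : exists k, t < rnorm (T h k).
  apply: contrapT => /forallNP nk; move: tT; rewrite ltNge => /negP; apply.
  by apply: ell_infty_ub => k; rewrite leNgt; apply/negP.
exists k; apply: lt_le_trans tk _.
by apply: (@svar_ub _ (op_comp (coord R k) T)) => //; exact: weight_ind.
Qed.

End Coordinates.
End Semivariation.

(** * Operators which are not exhaustive *)

Section Factorization.
Variable R : realType.
Notation C := (R[i]^o).
Notation linf := (ell_infty R).

(** There are functions h j with disjoint supports and norm at most 1, and
    coordinates k j, such that T (h j) is larger than e at k j.  After
    Rosenthal's lemma the k j-th coordinate of T sees little of the supports
    other than the j-th one, so T is bounded below on the copy of l_infty formed
    by the sums of a j * h j; injectivity of l_infty gives the left inverse. *)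
Lemma factor_of_not_exhaustive (T : op linf linf) : ~ exhaustive (svarA T) ->
  exists A B : op linf linf, op_comp A (op_comp T B) = op_id linf.
Proof.
move=> /existsNP[c /existsNP[e /not_implyP[e0 /forallNP cT]]].
have /choice[h hP] j : exists h : linf,
    (forall n, rnorm (h n) <= ind R (c @^-1` [set j]) n) /\
    exists k, e < rnorm (T h k).
  have /negP := cT j; rewrite -ltNge => /svar_gt[|h hc eT].
    exact: weight_ind.
  exists h; split=> //; apply: contrapT => /forallNP nk; move: eT.
  rewrite ltNge => /negP; apply; apply: ell_infty_ub => k.
  by rewrite leNgt; apply/negP.
have /choice[k kP] j := (hP j).2.
pose mu j : dual linf := op_comp (coord R (k j)) T.
pose nu j (A : set nat) := svarA (mu j) (c @^-1` A).
have mu_sub j := svarA_submeasure (mu j).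
have [||||s [s_inj sP]] := @rosenthal R nu (rnorm T) (e / 2).
- by move=> j A B AB; have [_ mono _] := mu_sub j; apply: mono => n /AB.
- move=> j A B AB; rewrite /nu preimage_setU; apply: svarA_superadditive.
  by rewrite -preimage_setI AB preimage_set0.
- move=> j A; rewrite (submeasure_ge0 _ (mu_sub j)) /=.
  apply: le_trans (svarA_coord_le T (k j) _) _.
  rewrite -[leRHS]mulr1; apply: svar_bound; first exact: weight_ind.
  by move=> n; rewrite /ind; case: (n \in _); rewrite ?lexx ?ler01.
- by rewrite divr_gt0.
have h_le j n : rnorm (h j n) <= 1.
  apply: le_trans ((hP j).1 n) _.
  by rewrite /ind; case: (n \in _); rewrite ?lexx ?ler01.
have h0 j n : c n != j -> h j n = 0.
  move=> cj; apply/rnorm0_eq0/eqP; rewrite eq_le rnorm_ge0 andbT.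
  apply: le_trans ((hP j).1 n) _.
  by rewrite /ind memNset// => /= /eqP; apply/negP.
have /choice[idx idxP] n : exists o : option nat,
    (if o is Some j then s j = c n else forall j, s j <> c n).
  have [[j jn]|nj] := pselect (exists j, s j = c n); first by exists (Some j).
  by exists None => j jn; apply: nj; exists j.
(* b n a is the value at n of the sum of the a j * h (s j). *)
pose b n (a : linf) : C := if idx n is Some j then a j * h (s j) n else 0.
have [n a x y|n a|B Bb] := @op_ell_infty R linf b 1.
- rewrite /b; case: (idx n) => [j|]; last by rewrite scaler0 addr0.
  change ((a * x j + y j) * h (s j) n =
    a * (x j * h (s j) n) + y j * h (s j) n).
  by rewrite mulrDl mulrA.
- rewrite mul1r /b; case: (idx n) => [j|]; last by rewrite rnorm0 rnorm_ge0.
  by rewrite rnormM (le_trans (ler_piMr _ (h_le _ _))) ?rnorm_ge0 ?ell_infty_le.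
have below a : rnorm a <= 2 / e * rnorm (T (B a)).
  have key j : rnorm (a j) * e <= rnorm (T (B a)) + rnorm a * (e / 2).
    pose r := B a - a j *: h (s j).
    have rn n : rnorm (r n) <= rnorm a * ind R (c @^-1` (range s `\ s j)) n.
      rewrite -[X in rnorm X]/(B a n - a j * h (s j) n) Bb /b.
      have := idxP n; case: (idx n) => [i si|si].
        have [sij|sij] := eqVneq (s i) (s j).
          by rewrite (s_inj _ _ sij) subrr rnorm0 mulr_ge0 ?rnorm_ge0// ler0n.
        rewrite (h0 (s j)) -?si// mulr0 subr0 rnormM.
        have cn : (c @^-1` (range s `\ s j)) n.
          by split; [exists i|rewrite /= -si; apply/eqP].
        rewrite /ind (mem_set cn).
        rewrite mulr1 (le_trans (ler_piMr _ (h_le _ _))) ?rnorm_ge0//.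
        exact: ell_infty_le.
      rewrite (h0 (s j)); last by apply/eqP => /esym; exact: si.
      by rewrite mulr0 subr0 rnorm0 mulr_ge0 ?rnorm_ge0// ler0n.
    have mur : rnorm (mu (s j) r) <= rnorm a * (e / 2).
      have [a0|a0] := eqVneq (rnorm a) 0.
        rewrite a0 mul0r; have -> : r = 0.
          apply: ell_infty_ext => n; apply/rnorm0_eq0/eqP.
          by rewrite eq_le rnorm_ge0 andbT (le_trans (rn n))// a0 mul0r.
        by rewrite op_f0 rnorm0.
      have a1 : 0 < rnorm a by rewrite lt_neqAle eq_sym a0 rnorm_ge0.
      have w := weight_ind R (c @^-1` (range s `\ s j)).
      rewrite (le_trans (svar_ub (mu (s j)) (weightZ (ltW a1) w) rn))//.
      by rewrite (le_trans (svarZ _ a1 w))// ler_wpM2l ?rnorm_ge0// sP.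
    rewrite (@le_trans _ _ (rnorm (mu (s j) (a j *: h (s j)))))//.
      by rewrite op_fZ rnormZ ler_wpM2l ?rnorm_ge0// ltW// kP.
    have -> : a j *: h (s j) = B a - r by rewrite /r opprB addrCA subrr addr0.
    rewrite op_fB (le_trans (rnormB _ _))// lerD//.
    exact: ell_infty_le (T (B a)) _.
  have : rnorm a <= (rnorm (T (B a)) + rnorm a * (e / 2)) / e.
    by apply: ell_infty_ub => j; rewrite ler_pdivlMr.
  rewrite ler_pdivlMr// mulrAC ler_pdivlMr//.
  lra.
have [|S SP] := @ell_infty_injective R linf linf 1 (fun=> op_comp T B) (2 / e)
  (op_id linf).
  by move=> a; rewrite big_ord1; exact: below.
by exists (S ord0), B; rewrite SP big_ord1.
Qed.

End Factorization.

(** * Exhaustive operators are weakly compact *)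

Section WeakCompactness.
Variable R : realType.
Notation C := (R[i]^o).
Notation linf := (ell_infty R).

Lemma rnorm_sqr (z : C) : rnorm z ^+ 2 = complex.Re z ^+ 2 + complex.Im z ^+ 2.
Proof.
rewrite /rnorm normc_def; case: z => a b /=.
by rewrite sqr_sqrtr// addr_ge0// sqr_ge0.
Qed.

Lemma rnorm_parallelogram (z w : C) :
  rnorm (2^-1%:C *: (z + w)) ^+ 2 + rnorm (2^-1%:C *: (z - w)) ^+ 2 =
  2^-1 * rnorm z ^+ 2 + 2^-1 * rnorm w ^+ 2.
Proof.
rewrite !rnormZ !rnormRC !exprMn !rnorm_sqr ger0_norm//.
by case: z => a b; case: w => c d /=; field.
Qed.

Definition square_weight (f : linf) (n : nat) : R := rnorm (f n) ^+ 2.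

Lemma weight_square f : weight (square_weight f).
Proof.
split=> [n|]; first exact: sqr_ge0.
exists (rnorm f ^+ 2) => n.
by rewrite /square_weight lerXn2r ?nnegrE ?rnorm_ge0 ?ell_infty_le.
Qed.

Lemma halfD (V : lmodType R[i]) (f : V) : 2^-1%:C *: f + 2^-1%:C *: f = f.
Proof.
rewrite -scalerDl -rmorphD (_ : 2^-1 + 2^-1 = 1 :> R) ?scale1r//.
by field.
Qed.

Section QuadraticEnergy.
Variables (m : nat -> dual linf) (N : nat).

(** The square of the L^2-norm for the sum of the first N variations. *)
Definition energy (f : linf) : R := \sum_(k < N) svar (m k) (square_weight f).

Lemma energy_ge0 f : 0 <= energy f.
Proof. by apply: sumr_ge0 => k _; apply: svar_ge0; exact: weight_square. Qed.

(** The parallelogram law holds pointwise, and passes through the variations as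
    they are superadditive and subadditive.  It makes the energy uniformly
    convex. *)
Lemma energy_midpoint f g :
  energy (2^-1%:C *: (f + g)) + energy (2^-1%:C *: (f - g)) <=
  2^-1 * energy f + 2^-1 * energy g.
Proof.
rewrite /energy -big_split !mulr_sumr -big_split; apply: ler_sum => k _ /=.
have w := weight_square; have h0 : 0 < (2^-1 : R) by [].
have wh f' := weightZ (ltW h0) (w f').
apply: le_trans (svar_superadditive (m k) (w _) (w _)) _.
apply: le_trans (lerD (svarZ (m k) h0 (w f)) (svarZ (m k) h0 (w g))).
apply: le_trans (svarD (m k) (wh f) (wh g)); apply: svar_mono => [||n].
- by apply: weightD; exact: w.
- by apply: weightD; exact: wh.
rewrite le_eqVlt; apply/orP; left; apply/eqP.
exact: (rnorm_parallelogram (f n) (g n)).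
Qed.

Lemma energy_chebyshev k (f : linf) (t : R) : (k < N)%N -> 0 < t ->
  svarA (m k) [set n | t < rnorm (f n)] <= t^-1 ^+ 2 * energy f.
Proof.
move=> kN t0; have w := weight_square f.
have t2 : 0 < t^-1 ^+ 2 by rewrite exprn_gt0// invr_gt0.
apply: (@le_trans _ _ (t^-1 ^+ 2 * svar (m k) (square_weight f))); last first.
  rewrite (ler_wpM2l (ltW t2))// /energy (bigD1 (Ordinal kN))//= lerDl.
  by apply: sumr_ge0 => j _; apply: svar_ge0; exact: weight_square.
apply: le_trans (svarZ (m k) t2 w); apply: svar_mono => [||n].
- exact: weight_ind.
- exact: weightZ (ltW t2) w.
rewrite /ind; case: (boolP (n \in _)) => [/set_mem /= tn|_]; last first.
  by apply: mulr_ge0; [exact: ltW|exact: sqr_ge0].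
rewrite /square_weight -exprMn exprn_ege1// mulrC ler_pdivlMr// mul1r.
exact: ltW.
Qed.

End QuadraticEnergy.

(** A function of small energy is small outside a set which, by Chebyshev's
    inequality, is small for finitely many coordinates of T, hence for all of
    them by uniform control. *)
Lemma exhaustive_energy_control (T : op linf linf) (e : R) :
  exhaustive (svarA T) -> 0 < e ->
  exists N d, 0 < d /\ forall u : linf, rnorm u <= 1 ->
    energy (fun k => op_comp (coord R k) T) N u < d -> rnorm (T u) <= e.
Proof.
move=> exhT e0; have e2 : 0 < e / 2 by rewrite divr_gt0.
have [N [d [d0 Nd]]] := uniform_control (svarA_submeasure T)
  (fun k => svarA_submeasure (op_comp (coord R k) T)) (@svarA_coord_le R T)
  (@svarA_coord_sup R T) exhT e2.
pose t := e / 2 / (rnorm T + 1).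
have t0 : 0 < t by rewrite divr_gt0// ltr_wpDl// rnorm_ge0.
exists N, (t ^+ 2 * d); split; first by rewrite mulr_gt0// exprn_gt0.
move=> u u1 ud.
pose A := [set n | t < rnorm (u n)].
have etaA : svarA T A <= e / 2.
  apply: Nd => k kN.
  have := energy_chebyshev (fun k => op_comp (coord R k) T) u kN t0.
  move/le_lt_trans; apply.
  by rewrite exprVn ltr_pdivrMl// exprn_gt0.
have [u1' u1E] : exists v : linf, v =1 fun n => if n \in A then u n else 0.
  apply: (@ell_infty_of R _ 1) => n; case: ifP => _; last by rewrite rnorm0.
  exact: le_trans (ell_infty_le _ _) u1.
rewrite -(subrKC u1' u) op_fD (le_trans (rnormD _ _))// [leRHS]splitr lerD//.
  apply: le_trans _ etaA; apply: svar_ub => [|n]; first exact: weight_ind.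
  rewrite u1E /ind; case: ifP => _; last by rewrite rnorm0.
  exact: le_trans (ell_infty_le _ _) u1.
rewrite (le_trans (op_rnorm_le _ _))//.
rewrite (@le_trans _ _ (rnorm T * t))//; last first.
  by rewrite ltW// mul_div_lt// rnorm_ge0.
rewrite ler_wpM2l ?rnorm_ge0//; apply: ell_infty_ub => n.
rewrite -[X in rnorm X]/(u n - u1' n) u1E.
case: ifPn => [_|nA]; first by rewrite subrr rnorm0 ltW.
by rewrite subr0 leNgt; apply: contra nA => tn; rewrite inE.
Qed.

(** Uniform convexity: among the convex members of an ultrafilter on the ball,
    one nearly maximises the least energy, and all its elements of nearly least
    energy have almost the same image. *)
Lemma exhaustive_ultra_concentration (T : op linf linf) (U : set_system linf)
    (e : R) :
  exhaustive (svarA T) -> UltraFilter U -> U (@unit_ball R linf) -> 0 < e ->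
  exists f : linf, rnorm f <= 1 /\
    forall S, U S -> (forall f g, S f -> S g -> S (2^-1%:C *: (f + g))) ->
    exists g : linf, S g /\ rnorm (T f - T g) <= e.
Proof.
move=> exhT uU UB e0; have e2 : 0 < e / 2 by rewrite divr_gt0.
have [N [d [d0 Nd]]] := exhaustive_energy_control exhT e2.
pose q := energy (fun k => op_comp (coord R k) T) N.
pose good (S : set linf) := [/\ U S, forall f, S f -> rnorm f <= 1 &
  forall f g, S f -> S g -> S (2^-1%:C *: (f + g))].
pose A := [set x : R | exists S, good S /\ forall f, S f -> x <= q f].
have goodB : good (@unit_ball R linf).
  split=> // [f|f g]; rewrite !unit_ballE// => f1 g1.
  rewrite rnormZ rnormRC ger0_norm// (le_trans (ler_wpM2l _ (rnormD _ _)))//.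
  lra.
have supA : has_sup A.
  split.
    by exists 0, (@unit_ball R linf); split=> // f _; exact: energy_ge0.
  exists (\sum_(k < N) rnorm (op_comp (coord R k) T) * 1).
  move=> x [S [[US S1 _] xS]].
  have [f Sf] := filter_ex US; rewrite (le_trans (xS f Sf))//.
  apply: ler_sum => k _; apply: svar_bound; first exact: weight_square.
  move=> n; rewrite /square_weight -(expr1n _ 2) lerXn2r ?nnegrE ?rnorm_ge0//.
  by rewrite (le_trans (ell_infty_le _ _))// S1.
(* D is the supremum, over the good sets, of the least energy on the set. *)
pose D := sup A.
have k0 : 0 < d / 3 by rewrite divr_gt0.
have [x [S0 [goodS0 xS0]] Dx] := sup_adherent k0 supA.
have low S : good S -> exists f, S f /\ S0 f /\ q f < D + d / 3.
  move=> [US S1 SM]; apply: contrapT => nex.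
  have : D + d / 3 <= D.
    apply: sup_upper_bound => //; exists (S `&` S0); split.
      have [US0 S01 S0M] := goodS0; split; first exact: filterI.
        by move=> f [/S1].
      by move=> f g [? ?] [? ?]; split; [exact: SM|exact: S0M].
    move=> f [Sf S0f]; rewrite leNgt; apply/negP => qf.
    by apply: nex; exists f.
  by rewrite gerDl leNgt k0.
have [f [_ [S0f qf]]] := low _ goodB.
have [US0 S01 S0M] := goodS0.
exists f; split; first exact: S01.
move=> S US SM.
have [|g [[Sg Bg] [S0g qg]]] := low (S `&` @unit_ball R linf).
  split; first exact: filterI.
    by move=> h [_]; rewrite unit_ballE.
  have [_ _ BM] := goodB.
  by move=> h h' [? ?] [? ?]; split; [exact: SM|exact: BM].
exists g; split=> //.
pose u : linf := 2^-1%:C *: (f - g).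
have u1 : rnorm u <= 1.
  rewrite rnormZ rnormRC ger0_norm// (le_trans (ler_wpM2l _ (rnormB _ _)))//.
  have := S01 _ S0f; have := S01 _ S0g; lra.
have qu : q u < d.
  have := energy_midpoint (fun k => op_comp (coord R k) T) N f g.
  rewrite -/u -/(q _) -/(q _) -/(q _) -/(q _) => qm.
  have := xS0 _ (S0M _ _ S0f S0g); rewrite -/D in Dx => xq.
  lra.
have := Nd u u1 qu; rewrite -op_fB => Tu.
rewrite -[f - g]halfD -/u op_fD (le_trans (rnormD _ _))// [leRHS]splitr.
by rewrite lerD.
Qed.

(** Along an ultrafilter on the ball, phi (T f) has a limit l phi for each
    functional phi.  By concentration there is, for each e, a single f with
    phi (T f) within e of l phi for all phi of norm at most 1, so the point y
    with the coordinates l (coord k) represents l. *)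
Lemma exhaustive_weakly_compact (T : op linf linf) :
  exhaustive (svarA T) -> weakly_compact_op T.
Proof.
move=> exhT; apply/weakly_compact_opP => U uU UB.
have /choice[l lP] (phi : dual linf) : exists z : C, phi \o T @ U --> z.
  apply: (ultra_cvg_scalar uU (r := rnorm (op_comp phi T))).
  exact: (ball_image_bounded (op_comp phi T)).
have conc (e : R) : 0 < e -> exists f : linf,
    forall phi : dual linf, rnorm (phi (T f) - l phi) <= rnorm phi * e.
  move=> e0; have [f [f1 fS]] := exhaustive_ultra_concentration exhT uU UB e0.
  exists f => phi; apply/ler_addgt0Pr => t t0.
  pose S := [set g : linf | rnorm (l phi - phi (T g)) < t].
  have US : U S by have /cvg_rnormP/(_ _ t0) := lP phi.
  have [|g [Sg Tg]] := fS S US.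
    move=> g h; rewrite /S /= => gt ht.
    have -> : l phi - phi (T (2^-1%:C *: (g + h))) =
        2^-1%:C *: ((l phi - phi (T g)) + (l phi - phi (T h))).
      rewrite !op_fZ !op_fD [in RHS]addrACA -opprD scalerBr; congr (_ - _).
      by rewrite scalerDr halfD.
    rewrite rnormZ rnormRC ger0_norm//.
    rewrite (le_lt_trans (ler_wpM2l _ (rnormD _ _)))//; lra.
  rewrite (le_trans (rnormB_trans (phi (T g)) _ _))// lerD//.
    rewrite -op_fB (le_trans (op_rnorm_le _ _))// ler_wpM2l ?rnorm_ge0//.
  by rewrite rnormBC ltW.
have coord1 k : rnorm (coord R k) <= 1.
  by apply: op_rnorm_ub => f f1; exact: le_trans (ell_infty_le f k) f1.
have [y yl] : exists y : linf, y =1 fun k => l (coord R k).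
  have [f fl] := conc 1 ltr01.
  apply: (@ell_infty_of R _ (rnorm (T f) + 1)) => k.
  have := fl (coord R k); rewrite mulr1 => h.
  rewrite (le_trans (rnorm_leB _ (coord R k (T f))))// lerD//.
    exact: ell_infty_le.
  by rewrite rnormBC (le_trans h).
exists y => phi; suff -> : phi y = l phi by exact: lP.
apply/eqP; rewrite -subr_eq0; apply/eqP/rnorm0_eq0/eqP.
rewrite eq_le rnorm_ge0 andbT; apply/ler_addgt0Pr => e e0; rewrite add0r.
pose p := 2 * rnorm phi.
have p0 : 0 <= p by rewrite mulr_ge0 ?rnorm_ge0.
have [|f fl] := conc (e / (p + 1)); first by rewrite divr_gt0// ltr_wpDl.
have yf : rnorm (y - T f) <= e / (p + 1).
  apply: ell_infty_ub => k; rewrite -[X in rnorm X]/(y k - coord R k (T f)) yl.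
  rewrite rnormBC (le_trans (fl _))// ler_piMl//.
  by rewrite divr_ge0 ?addr_ge0 ?(ltW e0).
rewrite (le_trans (rnormB_trans (phi (T f)) _ _))//.
rewrite (le_trans _ (ltW (mul_div_lt p0 e0)))//.
have -> : p * (e / (p + 1)) =
  rnorm phi * (e / (p + 1)) + rnorm phi * (e / (p + 1)) by rewrite /p; ring.
rewrite lerD//.
by rewrite -op_fB (le_trans (op_rnorm_le _ _))// ler_wpM2l ?rnorm_ge0.
Qed.

End WeakCompactness.

(** * Operators which factor through X or through l_infty *)

Section FactoringOperators.
Variable R : realType.
Notation C := (R[i]^o).
Notation linf := (ell_infty R).

Lemma weakly_compact_or_factor (T : op linf linf) : ~ weakly_compact_op T ->
  exists A B : op linf linf, op_comp A (op_comp T B) = op_id linf.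
Proof.
move=> nT; apply: factor_of_not_exhaustive => exhT; apply: nT.
exact: exhaustive_weakly_compact.
Qed.

(** A weak limit of the indicators of the initial segments of nat could only be
    the constant sequence 1, from which it is separated by a limit along a free
    ultrafilter. *)
Lemma ell_infty_id_not_weakly_compact : ~ weakly_compact_op (op_id linf).
Proof.
move=> wI; have [U [uU Uoo]] := exists_ultra_oo.
have /choice[l lP] (f : linf) : exists z : C, (f : nat -> C) @ U --> z.
  apply: (ultra_cvg_scalar uU (r := rnorm f)).
  by apply: filterE => n; exact: ell_infty_le.
have [a f g|f|phi phiE] := @op_of_linear R linf C l 1.
- apply: (cvg_rnorm_unique uU (lP _)).
  rewrite (_ : ell_infty_seq _ = (fun n => a *: f n) + (g : nat -> C))//.
  by apply: cvgD (lP g); exact: (@cvgZl_tmp _ _ _ _ _ a _ _ (lP f)).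
- rewrite mul1r; apply: (cvg_rnorm_le uU (lP f)).
  by apply: filterE => n; exact: ell_infty_le.
have /choice[x xE] N : exists f : linf, f =1 fun n => (n < N)%:R.
  apply: (@ell_infty_of R _ 1) => n.
  by case: (n < N)%N; rewrite ?rnorm1// rnorm0 ler01.
have [|y Iy] := weakly_compact_op_ultra uU (f := x) (r := 1) wI.
  apply: filterE => N; apply: ell_infty_ub => n; rewrite xE.
  by case: (n < N)%N; rewrite ?rnorm1// rnorm0 ler01.
have y1 n : y n = 1.
  apply: (cvg_rnorm_unique uU (Iy (coord R n))).
  apply/cvg_rnormP => e e0; apply: Uoo; exists n.+1 => // N /= nN.
  by rewrite xE nN subrr rnorm0.
have ly1 : l y = 1.
  apply: (cvg_rnorm_unique uU (lP y)).
  apply/cvg_rnormP => e e0; apply: filterE => n /=.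
  by rewrite y1 subrr rnorm0.
have ly0 : l y = 0.
  rewrite -phiE; apply: (cvg_rnorm_unique uU (Iy phi)).
  apply/cvg_rnormP => e e0; apply: filterE => N /=.
  rewrite (_ : phi (x N) = 0) ?subrr ?rnorm0// phiE.
  apply: (cvg_rnorm_unique uU (lP (x N))).
  apply/cvg_rnormP => t t0; apply: Uoo; exists N => // n /= Nn.
  by rewrite xE ltnNge Nn subrr rnorm0.
by move/eqP: ly1; rewrite ly0 eq_sym oner_eq0.
Qed.

Section VeryFewOperators.
Variables (X : normedModType R[i]) (U : op X linf).
Variables (L : dual X -> dual linf) (M : R).
Hypothesis UL : bidual_embedding U L M.
Hypothesis vfo : very_few_operators X.

(** Otherwise the identity of l_infty would factor through X. *)
Lemma factor_through_X_weakly_compact (S : op X linf) (T : op linf X) :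
  weakly_compact_op (op_comp S T).
Proof.
apply: contrapT => /weakly_compact_or_factor[A [B AB]].
apply: (@ell_infty_not_complemented R X (op_comp A S) (op_comp T B) vfo).
by rewrite -AB; exact: op_ext.
Qed.

(** X is not complemented in its bidual: the projection would be weakly
    compact, since l_infty is not complemented in X; hence X would be
    reflexive, and equal to l_infty. *)
Lemma embedding_not_complemented (P : op linf X) : op_comp P U <> op_id X.
Proof.
move=> PU; have PUx x : P (U x) = x by rewrite -[LHS]/(op_comp P U x) PU.
have wUP := @factor_through_X_weakly_compact U P.
have [U0 [uU0 U0oo]] := exists_ultra_oo.
apply: (@ell_infty_not_complemented R X U P vfo).
apply: op_ext => f; apply: ell_infty_ext => n.
have [x [xM xf]] := bidual_goldstine UL f.
have [|y Py] := weakly_compact_op_ultra uU0 (f := fun N => U (x N))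
    (r := rnorm U * (M * rnorm f + 1)) wUP.
  apply: filterE => N /=; rewrite (le_trans (op_rnorm_le _ _))//.
  by rewrite ler_wpM2l ?rnorm_ge0.
have coordf k : (fun N => U (x N) k : C) @ U0 --> (f k : C).
  rewrite -(bidual_coord UL k f) => A.
  by move=> /(xf (op_comp (coord R k) U)) /U0oo.
have yf : y = f.
  apply: ell_infty_ext => k.
  apply: (cvg_rnorm_unique uU0 (Py (coord R k))).
  rewrite (_ : _ \o _ = fun N => U (x N) k); first exact: coordf.
  by apply/funext => N /=; rewrite PUx.
have := Py (op_comp (coord R n) (op_comp U P)); rewrite yf => Pf.
apply: (cvg_rnorm_unique uU0 Pf).
rewrite (_ : _ \o _ = fun N => U (x N) n); first exact: coordf.
by apply/funext => N /=; rewrite !PUx.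
Qed.

(** If S T were c + K with c nonzero and K compact, extensions of T and K to the
    bidual would complement X in it. *)
Lemma factor_through_ell_infty_compact (T : op X linf) (S : op linf X) :
  compact_op (op_comp S T).
Proof.
have [c [K [cK ST]]] := vfo.2 (op_comp S T).
have [c0|c0] := eqVneq c 0.
  by rewrite ST c0 scale0r add0r.
have [W WU] := bidual_extension UL T.
have [V [VU _]] := compact_bidual_extension UL cK.
case: (@embedding_not_complemented (c^-1 *: (op_comp S W - V))).
apply: op_ext => x.
rewrite -[LHS]/(c^-1 *: (S (W (U x)) - V (U x))).
rewrite -[W (U x)]/(op_comp W U x) -[V (U x)]/(op_comp V U x) WU VU.
by rewrite -[S (T x)]/(op_comp S T x) ST opD addrK opZ scalerA mulVf// scale1r.
Qed.

End VeryFewOperators.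

(** * Weakly bounded sets are bounded *)

Section WeaklyBounded.
Variable E : normedModType R[i].

(** The uniform boundedness principle for the dual of E, by a gliding hump: the
    signs of the terms of a geometric series of norming functionals are chosen
    so that its k-th partial sum does not cancel at the k-th bad vector. *)
Lemma weakly_dominated (N : E -> R) : (forall x, 0 <= N x) ->
  (forall psi : dual E, exists c, forall x, rnorm (psi x) <= c * N x) ->
  exists c, forall x, rnorm x <= c * N x.
Proof.
move=> N0 wd; apply: contrapT => /forallNP nd.
have /choice[x xP] k : exists x, 9 ^+ k * N x < rnorm x.
  have /existsNP[x /negP] := nd (9 ^+ k); rewrite -ltNge => xk.
  by exists x.
have x0 k : 0 < rnorm (x k).
  by rewrite (le_lt_trans _ (xP k))// mulr_ge0// exprn_ge0.
have /choice[chi chiP] k := norming_functional (x k).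
pose t (k : nat) : R := 3^-1 ^+ k.
have t0 k : 0 < t k by rewrite exprn_gt0.
have tS k : t k.+1 = 3^-1 * t k by rewrite /t exprS.
pose step (k : nat) (A : dual E) : dual E :=
  if t k * rnorm (x k) <= rnorm ((A + (t k)%:C *: chi k) (x k))
  then A + (t k)%:C *: chi k else A - (t k)%:C *: chi k.
pose A := fix A k := if k is k'.+1 then step k' (A k') else 0.
have sign (u w : C) r : rnorm w = r -> rnorm (u + w) < r -> r <= rnorm (u - w).
  by move=> <-; exact: rnorm_add_or_sub.
have A_big k : t k * rnorm (x k) <= rnorm (A k.+1 (x k)).
  have v : rnorm (((t k)%:C *: chi k) (x k)) = t k * rnorm (x k).
    by rewrite opZ rnormZ (chiP k).2 !rnormRC !ger0_norm ?rnorm_ge0// ltW.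
  rewrite /= /step opD; case: ifPn => //; rewrite -ltNge => small.
  by rewrite op_subE; exact: sign v small.
have tchi k y : rnorm (((t k)%:C *: chi k) y) <= t k * rnorm y.
  rewrite opZ rnormZ rnormRC ger0_norm ?(ltW (t0 k))//.
  by rewrite ler_wpM2l ?(ltW (t0 k))// (chiP k).1.
have A_step k y : rnorm (A k.+1 y - A k y) <= t k * rnorm y.
  rewrite /= /step; case: ifP => _.
    by rewrite opD addrAC subrr add0r.
  by rewrite op_subE addrAC subrr add0r rnormN.
(* 3 / 2 is the sum of the geometric series of ratio 1 / 3. *)
have A_tail k m y : rnorm (A (k + m)%N y - A k y) <= (3 / 2 * t k) * rnorm y.
  apply: (@le_trans _ _ ((3 / 2 * (t k - t (k + m)%N)) * rnorm y)); last first.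
    by rewrite ler_wpM2r ?rnorm_ge0// ler_wpM2l// gerBl ltW.
  elim: m => [|m IH]; first by rewrite addn0 !subrr rnorm0 mulr0 mul0r.
  rewrite addnS (le_trans (rnormB_trans (A (k + m)%N y) _ _))//.
  rewrite (le_trans (lerD (A_step _ _) IH))// -mulrDl ler_wpM2r ?rnorm_ge0//.
  rewrite le_eqVlt; apply/orP; left; apply/eqP.
  by rewrite tS; field.
have [U [uU Uoo]] := exists_ultra_oo.
have /choice[a aP] y : exists z : C, (fun k => A k y) @ U --> z.
  apply: (ultra_cvg_scalar uU (r := 3 / 2 * t 0 * rnorm y)).
  by apply: filterE => k /=; have := A_tail 0%N k y; rewrite add0n subr0.
have [c y z|y|psi psiE] := @op_of_linear R E C a (3 / 2 * t 0).
- apply: (cvg_rnorm_unique uU (aP _)).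
  rewrite (_ : (fun k => _) = (fun k => c *: A k y) + (fun k => A k z)).
    by apply: cvgD; [apply: cvgZl_tmp; exact: aP|exact: aP].
  by apply/funext => k; rewrite op_fD op_fZ.
- apply: (cvg_rnorm_le uU (aP y)); apply: filterE => k /=.
  by have := A_tail 0%N k y; rewrite add0n subr0.
have psi_big k : t k / 2 * rnorm (x k) <= rnorm (psi (x k)).
  have : rnorm (psi (x k) - A k.+1 (x k)) <= t k / 2 * rnorm (x k).
    rewrite psiE.
    apply: (cvg_rnorm_le uU (f := fun m => A m (x k) - A k.+1 (x k))).
      by apply: cvgB; [exact: aP|exact: cvg_cst].
    apply: Uoo; exists k.+1 => // m /= km; rewrite -(subnKC km).
    rewrite (le_trans (A_tail _ _ _))// ler_wpM2r ?rnorm_ge0//.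
    by rewrite tS le_eqVlt; apply/orP; left; apply/eqP; field.
  have := A_big k; have := rnorm_leB (A k.+1 (x k)) (psi (x k)).
  rewrite rnormBC.
  lra.
have [c cP] := wd psi.
have c0 : 0 <= c.
  have h : 0 < c * N (x 0).
    rewrite (lt_le_trans _ (cP _))// (lt_le_trans _ (psi_big 0%N))//.
    by rewrite mulr_gt0// divr_gt0.
  rewrite leNgt; apply/negP => c0; move: h; rewrite ltNge => /negP; apply.
  by rewrite mulr_le0_ge0// ltW.
(* N (x k) is smaller than x k by the factor 9 ^- k, whereas psi (x k) is smaller
   by 3 ^- k / 2 at most. *)
have key k : 3 ^+ k <= 2 * c.
  have s0 : 0 < 3 ^+ k :> R by rewrite exprn_gt0.
  rewrite -(ler_pM2r (x0 k)).
  have xk : 3 ^+ k * 3 ^+ k * N (x k) <= rnorm (x k).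
    by rewrite -exprMn (_ : 3 * 3 = 9 :> R) ?ltW//; ring.
  have h : 3 ^+ k * 3 ^+ k * (t k / 2 * rnorm (x k)) <=
      3 ^+ k * 3 ^+ k * (c * N (x k)).
    by rewrite ler_pM2l ?mulr_gt0//; exact: le_trans (psi_big k) (cP _).
  have -> : 3 ^+ k * rnorm (x k) =
      2 * (3 ^+ k * 3 ^+ k * (t k / 2 * rnorm (x k))).
    by rewrite /t exprVn; field; rewrite gt_eqF.
  rewrite -[2 * c * _]mulrA ler_pM2l// (le_trans h)//.
  by rewrite mulrCA ler_wpM2l.
have := key (Num.truncn (2 * c)).+1; rewrite leNgt => /negP; apply.
rewrite (lt_le_trans (truncnS_gt _))// ltW// -natrX ltr_nat.
exact: ltn_expl.
Qed.

End WeaklyBounded.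
End FactoringOperators.

(** * Left ideals *)

Section LeftIdeals.
Variable A : pzRingType.
Implicit Types (L : set A).

Lemma left_ideal_sum L (n : nat) (s t : 'I_n -> A) : left_ideal L ->
  (forall i, L (t i)) -> L (\sum_i s i * t i).
Proof.
by move=> [L0 LD LM] Lt; elim/big_ind : _ => // i _; exact: LM.
Qed.

Lemma left_ideal1 L : left_ideal L -> L 1 -> L = setT.
Proof.
move=> [_ _ LM] L1; apply/seteqP; split=> // a _.
by rewrite -[a]mulr1; exact: LM.
Qed.

Lemma left_ideal_sub L a b : left_ideal L -> L a -> L b -> L (a - b).
Proof.
by move=> [_ LD LM] La Lb; rewrite -mulN1r; apply: LD => //; exact: LM.
Qed.

Lemma finitely_generated_family L : finitely_generated L ->
  exists n (t : 'I_n -> A), (forall i, L (t i)) /\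
    forall a, L a -> exists s : 'I_n -> A, a = \sum_i s i * t i.
Proof.
move=> [G _ ->]; exists (size G), (tnth (in_tuple G)); split=> [i|_ [s _ <-]].
  exists (fun t => if t == tnth (in_tuple G) i then 1 else 0) => //.
  rewrite (bigD1_seq (tnth (in_tuple G) i)) ?fset_uniq ?mem_tnth//=.
  rewrite eqxx mul1r big1 ?addr0// => t /negPf ->.
  by rewrite mul0r.
exists (fun i => s (tnth (in_tuple G) i)).
by rewrite big_tnth.
Qed.

Lemma finitely_generated_pair L (a b : A) : left_ideal L -> L a -> L b ->
  a != b -> (forall t, L t -> exists s s', t = s * a + s' * b) ->
  finitely_generated L.
Proof.
move=> [_ LD LM] La Lb ab Lab.
have sumE (s : A -> A) :
    \sum_(t <- (a |` [fset b])%fset) s t * t = s a * a + s b * b.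
  by rewrite big_fsetU1/= ?big_seq_fset1// inE.
exists (a |` [fset b])%fset; first by apply/fset0Pn; exists a; rewrite fset1U1.
apply/seteqP; split=> [t /Lab[s [s' ->]]|_ [s _ <-]] /=.
  exists (fun t => if t == a then s else s') => //.
  by rewrite sumE eqxx eq_sym (negPf ab).
by rewrite sumE; apply: LD; exact: LM.
Qed.

End LeftIdeals.

Section OperatorIdeals.
Variables (R : realType) (E : normedModType R[i]).
Notation C := (R[i]^o).
Notation linf := (ell_infty R).
Notation A := (op E E).

Fact op_vec_subproof (F : normedModType R[i]) (z : F) :
  (fun a : C => a *: z) \in bounded_linear _ F.
Proof.
rewrite inE; split=> [a b c|]; first by rewrite scalerDl scalerA.
by exists `|z| => a; rewrite normrZ mulrC.
Qed.

Definition rank1 (F : normedModType R[i]) (psi : dual E) (z : F) : op E F :=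
  op_comp (Op (op_vec_subproof z)) psi.

Lemma rank1E (F : normedModType R[i]) (psi : dual E) (z : F) x :
  rank1 psi z x = psi x *: z.
Proof. by []. Qed.

Lemma op_compE (F G : normedModType R[i]) (S : op F G) (T : op E F) x :
  op_comp S T x = S (T x).
Proof. by []. Qed.

Lemma op_mulE (S T : A) x : (S * T) x = S (T x).
Proof. by []. Qed.

Lemma op_1E x : (1 : A) x = x.
Proof. by []. Qed.

(** A maximal left ideal L which misses a rank-one operator R is fixed: since
    L + B(E) R is everything, L contains 1 - R' with R' of rank one, and hence
    every operator that vanishes on the range of R'.  With one that does not, L
    would contain the unit. *)
Lemma maximal_left_ideal_fixed (L : set A) (psi : dual E) (y : E) :
  maximal_left_ideal L -> ~ L (rank1 psi y) -> fixed_ideal L.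
Proof.
move=> [Lid LT Lmax] nLR; have [L0 LD LM] := Lid.
pose J := [set T | exists S S', L S /\ T = S + S' * rank1 psi y].
have Jid : left_ideal J.
  split; first by exists 0, 0; split=> //; rewrite mul0r addr0.
    move=> _ _ [S [S' [LS ->]]] [T [T' [LT' ->]]].
    exists (S + T), (S' + T'); split; first exact: LD.
    by rewrite mulrDl addrACA.
  move=> B _ [S [S' [LS ->]]]; exists (B * S), (B * S').
  by split; [exact: LM|rewrite mulrDr mulrA].
have [JL|JT] : J = L \/ J = setT.
- by apply: Lmax => // S LS; exists S, 0; split=> //; rewrite mul0r addr0.
- by case: nLR; rewrite -JL; exists 0, 1; split=> //; rewrite mul1r add0r.
have [S [S' [LS S1]]] : J 1 by rewrite JT.
pose z := S' y.
have SE x : S x = x - psi x *: z.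
  apply/eqP; rewrite eq_sym subr_eq; apply/eqP.
  by rewrite -[LHS]op_1E S1 opD op_mulE rank1E op_fZ.
have killz (T : A) : T z = 0 -> L T.
  move=> Tz; have -> : T = T * S; last exact: LM.
  by apply: op_ext => x; rewrite op_mulE SE op_fB op_fZ Tz scaler0 subr0.
have z0 : z != 0.
  apply/eqP => z0; apply: LT; apply: left_ideal1 => //.
  by apply: killz; rewrite op_1E.
exists z => //; apply/seteqP; split=> [T LT'|T]; last exact: killz.
apply: contrapT => Tz; apply: LT; apply: left_ideal1 => //.
have [chi [_ chiT]] := norming_functional (T z).
have nTz : (rnorm (T z))%:C != 0 :> C.
  by apply/eqP => /(congr1 (@complex.Re R))/= /rnorm0_eq0.
pose Q : A := rank1 chi ((rnorm (T z))%:C^-1 *: z).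
have QT : L (Q * T) by exact: LM.
have -> : 1 = (1 - Q * T) + Q * T :> A by rewrite subrK.
apply: LD => //; apply: killz.
by rewrite op_subE op_1E op_mulE rank1E chiT scalerA divff// scale1r subrr.
Qed.

(** Writing the rank-one operators psi (.) *: z through the generators bounds
    each functional psi by a multiple of the sum of the rnorm (Psi i x), which
    then dominates the norm. *)
Lemma generators_bounded_below (L : set A) n (Psi : 'I_n -> A) :
  (forall T, L T -> exists S : 'I_n -> A, T = \sum_i S i * Psi i) ->
  (forall psi y, L (rank1 psi y)) ->
  exists c, forall x, rnorm x <= c * \sum_i rnorm (Psi i x).
Proof.
move=> gen Lr.
have N0 x : 0 <= \sum_i rnorm (Psi i x).
  by apply: sumr_ge0 => i _; exact: rnorm_ge0.
have [[z z0]|Z] := pselect (exists z : E, z != 0); last first.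
  exists 0 => x; rewrite mul0r (_ : x = 0) ?rnorm0//.
  by apply: contrapT => /eqP x0; apply: Z; exists x.
apply: weakly_dominated => // psi.
have [S SP] := gen _ (Lr psi z).
have nz : 0 < rnorm z by rewrite rnorm_gt0.
exists ((\sum_i rnorm (S i)) / rnorm z) => x.
rewrite mulrAC ler_pdivlMr// -rnormZ -(rank1E psi z x) SP op_sumE.
rewrite (le_trans (rnorm_sum _ _ _))// mulr_suml; apply: ler_sum => i _.
rewrite op_mulE (le_trans (op_rnorm_le _ _))// ler_wpM2l ?rnorm_ge0//.
by rewrite (bigD1 i)//= lerDl sumr_ge0// => j _; exact: rnorm_ge0.
Qed.

(** The generators embed E into a finite power of E, from which T extends by
    injectivity of l_infty: T is a combination of the generators. *)
Lemma factors_through_ell_infty_mem (L : set A) (S : op linf E)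
    (T : op E linf) :
  left_ideal L -> finitely_generated L -> (forall psi y, L (rank1 psi y)) ->
  L (op_comp S T).
Proof.
move=> Lid /finitely_generated_family[n [Psi [LPsi gen]]] Lr.
have [c cP] := generators_bounded_below gen Lr.
have [W ->] := ell_infty_injective T cP.
have -> : op_comp S (\sum_i op_comp (W i) (Psi i)) =
    \sum_i (op_comp S (W i) : A) * Psi i.
  by apply: op_ext => x; rewrite op_sumE op_compE op_sumE op_fsum.
exact: left_ideal_sum.
Qed.

End OperatorIdeals.

(** * The ideals of operators on the direct sum *)

Section DirectSumIdeals.
Variables (R : realType) (X : normedModType R[i]).
Notation C := (R[i]^o).
Notation linf := (ell_infty R).
Notation E := (X * linf)%type.
Notation inl := (op_inl X linf).
Notation inr := (op_inr X linf).
Notation fst := (op_fst X linf).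
Notation snd := (op_snd X linf).

Hypothesis vfo : very_few_operators X.
Variables (U : op X linf) (L : dual X -> dual linf) (M : R).
Hypothesis UL : bidual_embedding U L M.

Lemma op_sum_id : op_comp inl fst + op_comp inr snd = 1 :> op E E.
Proof.
apply: op_ext => -[x y]; rewrite opD.
by apply: injective_projections; rewrite /= ?addr0 ?add0r.
Qed.

Lemma entry11D (S T : op E E) : entry11 (S + T) = entry11 S + entry11 T.
Proof. exact: op_ext. Qed.

Lemma entry22D (S T : op E E) : entry22 (S + T) = entry22 S + entry22 T.
Proof. exact: op_ext. Qed.

Lemma entry11M (S T : op E E) : entry11 (S * T) =
  op_comp (entry11 S) (entry11 T) +
  op_comp (op_comp fst (op_comp S inr)) (op_comp snd (op_comp T inl)).
Proof.
apply: op_ext => x; rewrite opD.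
have {1}-> : S * T = S * (op_comp inl fst + op_comp inr snd) * T.
  by rewrite op_sum_id mulr1.
rewrite mulrDr mulrDl entry11D opD; congr (_ + _).
Qed.

Lemma entry22M (S T : op E E) : entry22 (S * T) =
  op_comp (op_comp snd (op_comp S inl)) (op_comp fst (op_comp T inr)) +
  op_comp (entry22 S) (entry22 T).
Proof.
apply: op_ext => x; rewrite opD.
have {1}-> : S * T = S * (op_comp inl fst + op_comp inr snd) * T.
  by rewrite op_sum_id mulr1.
rewrite mulrDr mulrDl entry22D opD; congr (_ + _).
Qed.

(** The (1, 1) entry of a product S * T is, up to a composition of (1, 1)
    entries, an operator on X which factors through l_infty. *)
Lemma K1_two_sided_ideal : two_sided_ideal (K1 X linf).
Proof.
have KM (S T : op E E) : compact_op (entry11 S) \/ compact_op (entry11 T) ->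
    compact_op (entry11 (S * T)).
  move=> ST; rewrite entry11M; apply: compact_opD.
    by case: ST => [cS|cT]; [exact: compact_op_compr|exact: compact_op_compl].
  exact: (factor_through_ell_infty_compact UL vfo).
split; last by move=> S T KS; apply: KM; left.
split=> [|S T KS KT|S T KT].
- rewrite /K1 /= (_ : entry11 0 = 0); first exact: compact_op0.
  exact: op_ext.
- by rewrite /K1 /= entry11D; exact: compact_opD.
- by apply: KM; right.
Qed.

Lemma K1_proper : ~ K1 X linf 1.
Proof.
rewrite /K1 /= (_ : entry11 1 = op_id X); last exact: op_ext.
exact: op_id_not_compact UL vfo.
Qed.

(** This gives K1 codimension one, which makes it maximal. *)
Lemma K1_scalar (T : op E E) : exists c : C, K1 X linf (T - c *: op_id E).
Proof.
have [c [K [cK TK]]] := vfo.2 (entry11 T).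
exists c; rewrite /K1 /= (_ : entry11 _ = K)//.
apply: op_ext => x; rewrite -[LHS]/(entry11 T x - c *: x) TK opD.
by rewrite addrAC subrr add0r.
Qed.

Lemma K1_maximal : maximal_left_ideal (K1 X linf).
Proof.
split; first exact: K1_two_sided_ideal.1.
  by move=> K1T; apply: K1_proper; rewrite K1T.
move=> J Jid KJ; have [JK|] := pselect (J `<=` K1 X linf).
  by left; apply/seteqP.
move=> /existsNP[T /not_implyP[JT KT]]; right; apply: left_ideal1 => //.
have [c KTc] := K1_scalar T.
have c0 : c != 0.
  by apply: contra_not_neq KT => c0; move: KTc; rewrite c0 scale0r subr0.
have -> : 1 = (c^-1 *: op_id E) * (T - (T - c *: op_id E)) :> op E E.
  apply: op_ext => x; rewrite op_mulE opZ !op_subE opZ subKr scalerA.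
  by rewrite mulVf// scale1r.
have [_ _ JM] := Jid; apply: JM; apply: left_ideal_sub => //.
exact: KJ.
Qed.

(** Compact operators on X and operators from X to l_infty both extend to the
    bidual l_infty through U, which provides the two generators of K1. *)
Lemma K1_finitely_generated : finitely_generated (K1 X linf).
Proof.
pose G1 : op E E := op_comp inr (op_comp U fst).
pose G2 : op E E := op_comp inr snd.
have [Kid _] := K1_two_sided_ideal.
have kill (T : op E E) : (forall x, (T (x, 0)).1 = 0) -> K1 X linf T.
  move=> T0; rewrite /K1 /= (_ : entry11 T = 0); first exact: compact_op0.
  by apply: op_ext => x; exact: T0.
apply: (@finitely_generated_pair _ _ G1 G2) => //.
- by apply: kill.
- by apply: kill.
- apply/eqP => G12.
  have : G1 (0, ell_infty_unit R 0%N) = G2 (0, ell_infty_unit R 0%N).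
    by rewrite G12.
  move=> /(congr1 (fun p : E => p.2 0%N)).
  rewrite /= op_f0 ell_infty_unitE eqxx => /esym/eqP.
  by rewrite oner_eq0.
move=> T KT; have [V [VU _]] := compact_bidual_extension UL KT.
have [W WU] := bidual_extension UL (op_comp snd (op_comp T inl)).
exists (op_comp (op_comp inl V + op_comp inr W) snd), T.
rewrite -[T in LHS]mulr1 -op_sum_id mulrDr; congr (_ + _).
apply: op_ext => -[x y].
rewrite !op_mulE -[RHS]/(inl (V (U x)) + inr (W (U x))).
rewrite -[V (U x)]/(op_comp V U x) -[W (U x)]/(op_comp W U x) VU WU.
by apply: injective_projections; rewrite /= ?addr0 ?add0r.
Qed.

(** The two generators of K1 have no common zero, since U is injective. *)
Lemma K1_not_fixed : ~ fixed_ideal (K1 X linf).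
Proof.
move=> [[a b] ab0 KE].
have kill (T : op E E) : (forall x, (T (x, 0)).1 = 0) -> T (a, b) = 0.
  move=> T0; have : K1 X linf T; last by rewrite KE.
  rewrite /K1 /= (_ : entry11 T = 0); first exact: compact_op0.
  by apply: op_ext => x; exact: T0.
have Ua : U a = 0.
  have := kill (op_comp inr (op_comp U fst)) (fun=> erefl).
  exact: (congr1 (fun p : E => p.2)).
have b0 : b = 0.
  have := kill (op_comp inr snd) (fun=> erefl).
  exact: (congr1 (fun p : E => p.2)).
by move: ab0; rewrite (bidual_injective UL Ua) b0 eqxx.
Qed.

(** Such an ideal J contains the rank-one operators, hence all operators which
    factor through l_infty: these include the second coordinate projection, the
    (1, 2) entries and, by extension to the bidual, the compact (1, 1) entries.
    An element of J outside K1 would thus put the first coordinate projection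
    into J as well. *)
Lemma maximal_finitely_generated_eq_K1 (J : set (op E E)) :
  maximal_left_ideal J -> finitely_generated J -> ~ fixed_ideal J ->
  J = K1 X linf.
Proof.
move=> mJ fgJ nfJ; have [Jid JT Jmax] := mJ; have [J0 JD JM] := Jid.
have Jr psi y : J (rank1 psi y).
  by apply: contrapT => nJ; apply: nfJ; exact: maximal_left_ideal_fixed nJ.
have Jlinf (S : op linf E) (T : op E linf) : J (op_comp S T).
  exact: factors_through_ell_infty_mem.
suff JK : J `<=` K1 X linf.
  have [<-//|KT] := Jmax _ K1_two_sided_ideal.1 JK.
  by case: K1_proper; rewrite KT.
move=> T JT'; have [c KTc] := K1_scalar T.
have [c0|c0] := eqVneq c 0; first by move: KTc; rewrite c0 scale0r subr0.
case: JT; apply: left_ideal1 => //; rewrite -op_sum_id; apply: JD => //.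
have [V [VU _]] := compact_bidual_extension UL KTc.
pose P1 : op E E := op_comp inl fst; rewrite -/P1.
have -> : P1 = (c^-1 *: op_id E) *
    (P1 * T - op_comp (op_comp inl V) (op_comp U fst)
    - op_comp (op_comp inl (op_comp fst (op_comp T inr))) snd).
  apply: op_ext => -[x y].
  rewrite op_mulE opZ !op_subE.
  have -> : op_comp (op_comp inl V) (op_comp U fst) (x, y) =
      inl (entry11 T x - c *: x).
    by rewrite -[LHS]/(inl (op_comp V U x)) VU.
  have -> : (P1 * T) (x, y) = inl (entry11 T x) + inl ((T (inr y)).1).
    rewrite -op_fD; congr (inl _).
    rewrite -[entry11 T x]/((T (inl x)).1) -[RHS]/((T (inl x) + T (inr y)).1).
    rewrite -op_fD; congr (T _).1.
    by apply: injective_projections; rewrite /= ?addr0 ?add0r.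
  rewrite -[(op_comp (op_comp inl _) snd) _]/(inl ((T (inr y)).1)).
  rewrite addrAC addrK -op_fB subKr op_fZ scalerA mulVf// scale1r//.
apply: (JM); apply: left_ideal_sub => //; apply: left_ideal_sub => //.
exact: JM.
Qed.

Lemma W2_kill (T : op E E) : (forall y, (T (0, y)).2 = 0) -> W2 X linf T.
Proof.
move=> T0; rewrite /W2 /= (_ : entry22 T = 0); first exact: weakly_compact_op0.
by apply: op_ext => y; exact: T0.
Qed.

(** The identity of l_infty factors through every operator on l_infty which is
    not weakly compact, so an ideal that is larger than W2 contains the second
    coordinate projection; the first one is in W2. *)
Lemma W2_maximal : maximal_two_sided_ideal (W2 X linf).
Proof.
have WM (S T : op E E) : weakly_compact_op (entry22 S) \/
    weakly_compact_op (entry22 T) -> weakly_compact_op (entry22 (S * T)).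
  move=> ST; rewrite entry22M; apply: weakly_compact_opD.
    exact: factor_through_X_weakly_compact.
  case: ST => [wS|wT]; first exact: weakly_compact_op_compr.
  exact: weakly_compact_op_compl.
split.
- split; last by move=> S T WS; apply: WM; left.
  split=> [|S T WS WT|S T WT]; first by apply: W2_kill => y.
    by rewrite /W2 /= entry22D; exact: weakly_compact_opD.
  by apply: WM; right.
- move=> WT; apply: (@ell_infty_id_not_weakly_compact R).
  have : W2 X linf 1 by rewrite WT.
  by rewrite /W2 /= (_ : entry22 1 = op_id linf)//; exact: op_ext.
move=> J [Jid JMr] WJ; have [JW|] := pselect (J `<=` W2 X linf).
  by left; apply/seteqP.
move=> /existsNP[T /not_implyP[JT /weakly_compact_or_factor[A [B AB]]]].
right; apply: left_ideal1 => //; have [_ JD JM] := Jid.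
rewrite -op_sum_id; apply: JD; first by apply: WJ; apply: W2_kill.
have -> : op_comp inr snd = (op_comp inr (op_comp A snd) : op E E) * T *
    op_comp inr (op_comp B snd).
  apply: op_ext => -[x y]; rewrite !op_mulE.
  by rewrite -[RHS]/(inr (op_comp A (op_comp (entry22 T) B) y)) AB.
by apply: JMr; exact: JM.
Qed.

(** W2 contains the operators with values in X.  They have no common zero, and
    the first coordinate projection among them is not in K1. *)
Lemma W2_not_sub (J : set (op E E)) : maximal_left_ideal J ->
  finitely_generated J -> ~ (W2 X linf `<=` J).
Proof.
move=> mJ fgJ WJ.
have [[[a b] ab0 JE]|nfJ] := pselect (fixed_ideal J); last first.
  have JK := maximal_finitely_generated_eq_K1 mJ fgJ nfJ.
  apply: (op_id_not_compact UL vfo).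
  have : K1 X linf (op_comp inl fst) by rewrite -JK; apply: WJ; exact: W2_kill.
  by rewrite /K1 /= (_ : entry11 _ = op_id X)//; exact: op_ext.
have kill (T : op E E) : (forall y, (T (0, y)).2 = 0) -> T (a, b) = 0.
  by move=> /W2_kill /WJ; rewrite JE.
have a0 : a = 0.
  exact: (congr1 (fun p : E => p.1) (kill (op_comp inl fst) (fun=> erefl))).
have [x x0] : exists x : X, x != 0.
  apply: contrapT => nx; apply: (op_id_not_compact UL vfo).
  rewrite (_ : op_id X = 0); first exact: compact_op0.
  by apply: op_ext => x; apply: contrapT => /eqP x0; apply: nx; exists x.
have b0 : b = 0.
  apply: ell_infty_ext => n.
  have := kill (op_comp inl (rank1 (op_comp (coord R n) snd) x)) (fun=> erefl).
  move=> /(congr1 (fun p : E => p.1)) /eqP; rewrite -[_.1]/(b n *: x).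
  by rewrite scaler_eq0 (negPf x0) orbF => /eqP.
by move: ab0; rewrite a0 b0 eqxx.
Qed.

End DirectSumIdeals.

Theorem theorem1p6 (R : realType) (X_AH : completeNormedModType R[i])
    (X_AH_very_few_operators : very_few_operators X_AH)
    (X_AH_basis : exists e : nat -> X_AH, schauder_basis e)
    (X_AH_dual : isomorphic (dual X_AH) (ell_one R)) :
  let E := (X_AH * ell_infty R)%type in
  [/\ two_sided_ideal (K1 X_AH (ell_infty R)),
      forall L : set (op E E),
        maximal_left_ideal L /\ finitely_generated L /\ ~ fixed_ideal L <->
        L = K1 X_AH (ell_infty R),
      maximal_two_sided_ideal (W2 X_AH (ell_infty R))
    & forall L : set (op E E),
        maximal_left_ideal L -> finitely_generated L ->
        ~ (W2 X_AH (ell_infty R) `<=` L)].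
Proof.
move=> E; have [U [L [M UL]]] := bidual_embedding_of_dual_ell_one X_AH_dual.
have vfo := X_AH_very_few_operators.
split.
- exact: (@K1_two_sided_ideal R X_AH vfo U L M UL).
- move=> J; split=> [[mJ [fgJ nfJ]]|->].
    exact: (@maximal_finitely_generated_eq_K1 R X_AH vfo U L M UL).
  split; first exact: (@K1_maximal R X_AH vfo U L M UL).
  split; first exact: (@K1_finitely_generated R X_AH vfo U L M UL).
  exact: (@K1_not_fixed R X_AH U L M UL).
- exact: (@W2_maximal R X_AH vfo).
- exact: (@W2_not_sub R X_AH vfo U L M UL).
Qed.
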